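(* For each $N\in\mathbb{N}$ let $A_N$ be an $N\times N$ GOE random matrix, with law $\mathbb{P}_N$. Then the eigenvalue distribution $\mu_{A_N}$ converges in probability to the semicircle distribution $\mu_W$; namely, for each $z\in\mathbb{C}$ with $\operatorname{Im} z>0$ and all $\varepsilon>0$, $$\lim_{N\to\infty}\mathbb{P}_N\left\{A_N \;\middle|\; \left|S_{\mu_{A_N}}(z)-S_{\mu_W}(z)\right|\ge\varepsilon\right\}=0 .$$
   Context: An $N\times N$ GOE random matrix is a random real symmetric matrix $A_N=(x_{ij})_{i,j=1}^N$, $x_{ij}=x_{ji}$, distributed according to the probability measure $$d\mathbb{P}_N(A)=c_N\exp\left(-\tfrac N4\operatorname{Tr}(A^2)\right)\prod_{i\le j}dx_{ij}$$ on the space of real symmetric $N\times N$ matrices, with normalization constant $c_N$. Equivalently, $\{x_{ij}\mid i\le j\}$ are independent centered real Gaussians with variance $1/N$ for $i\ne j$ and $2/N$ for $i=j$. For a selfadjoint matrix $A$ with eigenvalues $\lambda_1,\dots,\lambda_N$ (counted with multiplicity), $\mu_A:=\frac1N(\delta_{\lambda_1}+\cdots+\delta_{\lambda_N})$. For a finite measure $\mu$ on $\mathbb{R}$, its Stieltjes transform is $S_\mu(z)=\int_{\mathbb{R}}\frac{1}{t-z}\,d\mu(t)$ for $z\in\mathbb{C}\setminus\mathbb{R}$. The semicircle distribution $\mu_W$ is the probability measure on $[-2,2]$ with density $\frac1{2\pi}\sqrt{4-x^2}$. Convergence in probability of the random measures $\mu_{A_N}$ to $\mu_W$ is understood in the sense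 of the displayed statement for Stieltjes transforms. *)

(* Defs.v *)
From HB Require Import structures.
From mathcomp Require Import all_boot all_order all_algebra.
From mathcomp Require Import polyrcf complex.
From mathcomp Require Import all_classical all_reals all_analysis.
From mathcomp Require Import measurable_realfun.
Set Implicit Arguments.
Unset Strict Implicit.
Unset Printing Implicit Defensive.
Import Order.TTheory GRing.Theory Num.Theory.
Import numFieldNormedType.Exports.

Local Open Scope classical_set_scope.
Local Open Scope ring_scope.
Local Open Scope complex_scope.

Section StieltjesTransform.
Context {R : realType}.

(* The complex-valued integral is taken componentwise. *)
Definition stieltjes (mu : {finite_measure set (measurableTypeR R) -> \bar R})
    (z : R[i]) : R[i] :=
  Rintegral mu setT (fun t : R => complex.Re (1 / (t%:C - z))) +i*
  Rintegral mu setT (fun t : R => complex.Im (1 / (t%:C - z))).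

End StieltjesTransform.

Section EmpiricalMeasure.
Context {R : realType}.

(* Only the real roots of the characteristic polynomial are listed, each
   repeated according to its algebraic multiplicity; when A is symmetric these
   are all its N eigenvalues. *)
Definition eigenvalues N (A : 'M[R]_N) : seq R :=
  flatten [seq nseq (mup x (char_poly A)) x | x <- rootsR (char_poly A)].

Definition empirical_measure N (A : 'M[R]_N) :
    set (measurableTypeR R) -> \bar R :=
  mscale ((N%:R^-1)%:nng)
    (msum (fun k => \d_((eigenvalues A)`_k : measurableTypeR R))
       (size (eigenvalues A))).

HB.instance Definition _ N (A : 'M[R]_N) :=
  Measure.on (empirical_measure A).

Let empirical_measure_finite N (A : 'M[R]_N) :
  fin_num_fun (empirical_measure A).
Proof.
apply: lty_fin_num_fun; rewrite /empirical_measure /mscale /msum.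
rewrite lte_mul_pinfty//.
by apply/lte_sum_pinfty => i _; rewrite /dirac ltry.
Qed.

HB.instance Definition _ N (A : 'M[R]_N) :=
  @Measure_isFinite.Build _ _ _ (empirical_measure A)
    (empirical_measure_finite A).

End EmpiricalMeasure.

Section Semicircle.
Context {R : realType}.

Definition semicircle_pdf (x : R) : R := (2 * pi)^-1 * Num.sqrt (4 - x ^+ 2).

Definition semicircle (B : set (measurableTypeR R)) : \bar R :=
  (\int[lebesgue_measure]_(x in B `&` `[(-2)%R, 2%R]) (semicircle_pdf x)%:E)%E.

Let semicircle_pdf_ge0 x : 0 <= semicircle_pdf x.
Proof. by rewrite mulr_ge0// ?sqrtr_ge0// invr_ge0 mulr_ge0// pi_ge0. Qed.

Let continuous_semicircle_pdf : continuous semicircle_pdf.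
Proof.
move=> x; apply: cvgM; first exact: cvg_cst.
apply: continuous_comp; last exact: sqrt_continuous.
by apply: cvgB; [exact: cvg_cst|exact: exprn_continuous].
Qed.

Let measurable_semicircle_pdf (D : set (measurableTypeR R)) :
  measurable_fun D semicircle_pdf.
Proof.
apply: (@measurable_funS _ _ _ _ setT) => //.
exact: continuous_measurable_fun.
Qed.

Let semicircle0 : semicircle set0 = 0%E.
Proof. by rewrite /semicircle set0I integral_set0. Qed.

Let semicircle_ge0 B : (0 <= semicircle B)%E.
Proof. by apply: integral_ge0 => x _; rewrite lee_fin. Qed.

Let semicircle_sigma_additive : semi_sigma_additive semicircle.
Proof.
move=> /= B mB tB mUB; rewrite /semicircle setI_bigcupl.
rewrite ge0_integral_bigcup//=.
- apply: is_cvg_ereal_nneg_natsum_cond => n _ _.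
  by apply: integral_ge0 => /= x _; rewrite lee_fin.
- by move=> n; apply: measurableI.
- by apply/measurable_EFinP.
- by move=> x _; rewrite lee_fin.
- exact: trivIset_setIr.
Qed.

HB.instance Definition _ := isMeasure.Build _ _ _
  semicircle semicircle0 semicircle_ge0 semicircle_sigma_additive.

Let semicircle_finite : fin_num_fun semicircle.
Proof.
apply: lty_fin_num_fun.
have semicircleT : semicircle setT =
    (\int[lebesgue_measure]_(x in `[(-2)%R, 2%R]) (semicircle_pdf x)%:E)%E.
  by rewrite /semicircle setTI.
rewrite [ltLHS]semicircleT.
apply: integrable_lty => //.
apply: continuous_compact_integrable; first exact: segment_compact.
by apply: continuous_subspaceT => x; exact: continuous_semicircle_pdf.
Qed.

HB.instance Definition _ :=
  @Measure_isFinite.Build _ _ _ semicircle semicircle_finite.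

End Semicircle.

Section LebesgueTuple.
Context {R : realType}.

Definition tuple_cons n (p : n.-tuple (measurableTypeR R) * measurableTypeR R)
  : n.+1.-tuple (measurableTypeR R) := [tuple of p.2 :: p.1].

Lemma measurable_tuple_cons n : measurable_fun setT (@tuple_cons n).
Proof. exact: measurable_cons. Qed.

Section lebesgue_tuple_rec.
Variables (n : nat)
  (m : {measure set (n.-tuple (measurableTypeR R)) -> \bar R}).

Definition lebesgue_tuple_rec :
    set (n.+1.-tuple (measurableTypeR R)) -> \bar R :=
  pushforward (m \x lebesgue_measure)%E (@tuple_cons n).

HB.instance Definition _ := Measure.copy lebesgue_tuple_rec
  (measure_function_pushforward__canonical__measure_function_Measure
     (m \x lebesgue_measure)%E (@measurable_tuple_cons n)).
End lebesgue_tuple_rec.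

(* Lebesgue measure on R^n, as an n-fold product measure. *)
Fixpoint lebesgue_tuple n :
    {measure set (n.-tuple (measurableTypeR R)) -> \bar R} :=
  if n is n'.+1 then lebesgue_tuple_rec (lebesgue_tuple n') else
  \d_([tuple] : 0.-tuple (measurableTypeR R)).

End LebesgueTuple.

Section GOE.
Context {R : realType}.

(* The pairs (i, j) with i <= j: they index the coordinates x_ij on the space
   of symmetric matrices, which is thereby identified with a space of tuples. *)
Definition upper_pairs N : seq ('I_N * 'I_N) :=
  [seq p : 'I_N * 'I_N <- enum {: 'I_N * 'I_N} | (p.1 <= p.2)%N].

Definition upper_coords N (A : 'M[R]_N) :
    (size (upper_pairs N)).-tuple (measurableTypeR R) :=
  [tuple of [seq A p.1 p.2 | p <- in_tuple (upper_pairs N)]].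

Definition sym_mx N (x : (size (upper_pairs N)).-tuple (measurableTypeR R)) :
    'M[R]_N :=
  \matrix_(i, j)
    (x : seq R)`_(index (if (i <= j)%N then (i, j) else (j, i)) (upper_pairs N)).

(* c is the normalization constant c_N: it is determined by P being a
   probability. *)
Definition GOE d (T : measurableType d) (P : probability T R) N
    (A : T -> 'M[R]_N) : Prop :=
  [/\ forall w, (A w)^T = A w,
      forall i j, measurable_fun setT (fun w => A w i j) &
      exists c : R,
        forall B : set ((size (upper_pairs N)).-tuple (measurableTypeR R)),
          measurable B ->
          P [set w | B (upper_coords (A w))] =
          (c%:E * \int[lebesgue_tuple (size (upper_pairs N))]_(x in B)
             (expR (- (N%:R / 4) * \tr (sym_mx x *m sym_mx x)))%:E)%E].

End GOE.

(* Main.v *)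
Require Import Defs.
From mathcomp Require Import all_boot all_order all_algebra.
From mathcomp Require Import polyrcf complex.
From mathcomp Require Import all_classical all_reals all_analysis.
From mathcomp Require Import measurable_realfun spectral sesquilinear ring lra.
Import Order.TTheory GRing.Theory Num.Theory.
Import numFieldNormedType.Exports.
Local Open Scope classical_set_scope.
Local Open Scope ring_scope.
Local Open Scope complex_scope.
Set Implicit Arguments.
Unset Strict Implicit.
Unset Printing Implicit Defensive.
Import ComplexField.Normc.

(** Write [G = (A - z)^-1] for the resolvent, [g = (1/N) tr G] for the Stieltjes
    transform of the spectral distribution, [y = Im z > 0], and
    [F = 1 + z g + g^2].  The Stieltjes transform [m] of the semicircle law is
    the root of [1 + z m + m^2 = 0] in the upper half plane, so the point is
    that [g] almost solves the same quadratic equation.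

    Integration by parts.  The Gaussian law is absorbed in one identity,
    [E[N x_ij f(A)] = E[D_ij f(A)]], where [D_ij] is the derivative in the
    direction [E_ij + E_ji] ([GOE_stein]); the factor 2 in the diagonal variances
    is exactly what makes the same formula hold for [i = j].  It is applied to
    [f_ij = G_ji conj F] and summed over [i, j].  Since
    [sum_ij x_ij G_ji = tr (A G) = N (1 + z g)] and
    [D_ij G = - G (E_ij + E_ji) G], the sum reads
    [N^2 E|F|^2 = - E[tr (G^2) conj F] + E[sum_ij G_ji conj (D_ij F)]],
    and the elementary bound [sum_j |G_ij|^2 <= y^-2] makes the right-hand side
    [O(N)].  Hence [E|F|^2 = O(1/N)] ([GOE_defect_second_moment]).  Taking [conj F]
    as the test factor yields this second moment directly, so that no separate
    concentration inequality for [g] enters.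

    Stability.  [F = (g - m) (g + z + m)], and the second factor has imaginary
    part at least [y] because [Im g >= 0] and [Im m > 0]; thus
    [|g - m| <= |F| / y] ([defect_stable]), and Markov's inequality concludes.

    The law.  The GOE is only given through its density with respect to Lebesgue
    measure on the coordinates, with an unspecified constant.  Translation
    invariance of Lebesgue measure gives the effect of a shift [A -> A + tD] on
    expectations ([GOE_shift]), whatever the constant is; it also provides the
    exponential moments of the linear forms of [A].  Letting [t -> 0] gives
    [GOE_stein].

    The two transforms.  [g] is the Stieltjes transform of the empirical measure by
    the spectral theorem ([stieltjes_empirical]).  For the semicircle, the density
    divided by [t - z] expands in powers of [m], with the Chebyshev polynomials of
    the second kind times [sqrt (4 - t^2)] as coefficients; all but the first
    integrate to 0 over [-2, 2] ([stieltjes_semicircle]). *)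

(* Inside ring expressions [z^*] would otherwise be [Num.conj z], which is
   convertible to [conjc z] but not identified with it by rewriting. *)
Local Notation "z ^*" := (conjc z) : ring_scope.

(** * Real and imaginary parts, modulus *)
Section ComplexParts.
Context {R : realType}.
Implicit Types x y z : R[i].

Lemma cReD x y : complex.Re (x + y) = complex.Re x + complex.Re y.
Proof. by case: x y => [a b] []. Qed.
Lemma cImD x y : complex.Im (x + y) = complex.Im x + complex.Im y.
Proof. by case: x y => [a b] []. Qed.
Lemma cReN x : complex.Re (- x) = - complex.Re x. Proof. by case: x. Qed.
Lemma cImN x : complex.Im (- x) = - complex.Im x. Proof. by case: x. Qed.
Lemma cReM x y : complex.Re (x * y) =
  complex.Re x * complex.Re y - complex.Im x * complex.Im y.
Proof. by case: x y => [a b] []. Qed.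
Lemma cImM x y : complex.Im (x * y) =
  complex.Re x * complex.Im y + complex.Im x * complex.Re y.
Proof. by case: x y => [a b] []. Qed.

Lemma cRe_realM (t : R) x : complex.Re (t%:C * x) = t * complex.Re x.
Proof. by case: x => a b /=; rewrite mul0r subr0. Qed.

Lemma cRe_sum I (r : seq I) (p : pred I) (F : I -> R[i]) :
  complex.Re (\sum_(i <- r | p i) F i) = \sum_(i <- r | p i) complex.Re (F i).
Proof. by apply: (big_morph _ cReD). Qed.
Lemma cIm_sum I (r : seq I) (p : pred I) (F : I -> R[i]) :
  complex.Im (\sum_(i <- r | p i) F i) = \sum_(i <- r | p i) complex.Im (F i).
Proof. by apply: (big_morph _ cImD). Qed.

Lemma normc_sqr x : normc x ^+ 2 = complex.Re x ^+ 2 + complex.Im x ^+ 2.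
Proof. by case: x => a b /=; rewrite sqr_sqrtr// addr_ge0 ?sqr_ge0. Qed.

Lemma normc_ge0 x : 0 <= normc x.
Proof. by case: x => a b /=; exact: sqrtr_ge0. Qed.

Lemma normc_conj x : normc x^* = normc x.
Proof. by case: x => a b /=; rewrite sqrrN. Qed.

Lemma normc_real (t : R) : normc t%:C = `|t|.
Proof. by rewrite /= expr0n addr0 sqrtr_sqr. Qed.

Lemma normc_ge_normRe x : `|complex.Re x| <= normc x.
Proof.
by rewrite -ler_sqr ?nnegrE ?normc_ge0// real_normK ?num_real// normc_sqr lerDl sqr_ge0.
Qed.

Lemma normc_ge_normIm x : `|complex.Im x| <= normc x.
Proof.
by rewrite -ler_sqr ?nnegrE ?normc_ge0// real_normK ?num_real// normc_sqr lerDr sqr_ge0.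
Qed.

Lemma le_normc_sum I (r : seq I) (p : pred I) (F : I -> R[i]) :
  normc (\sum_(i <- r | p i) F i) <= \sum_(i <- r | p i) normc (F i).
Proof.
elim/big_rec2: _ => [|i y x _ h]; first by rewrite normc0.
by apply: (le_trans (le_normcD _ _)); rewrite lerD2l.
Qed.

Lemma mulc_conj x : x * x^* = (normc x ^+ 2)%:C.
Proof.
rewrite normc_sqr; case: x => a b /=; apply/eqP; rewrite eq_complex/=.
by apply/andP; split; apply/eqP; ring.
Qed.

Lemma invc_conjE x :
  x^-1 = (complex.Re x ^+ 2 + complex.Im x ^+ 2)^-1%:C * x^*.
Proof.
case: x => a b; rewrite /= [LHS]/GRing.inv/=.
by apply/eqP; rewrite eq_complex/=; apply/andP; split; apply/eqP; ring.
Qed.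

Lemma cReJ x : @complex.Re R x^* = complex.Re x. Proof. by case: x. Qed.
Lemma cImJ x : @complex.Im R x^* = - complex.Im x. Proof. by case: x. Qed.

Lemma cIm_realM (t : R) x : complex.Im (t%:C * x) = t * complex.Im x.
Proof. by case: x => a b /=; rewrite mul0r addr0. Qed.

End ComplexParts.

(** * Measurable complex functions and matrices *)
Section MeasurableComplex.
Context d (T : measurableType d) {R : realType}.
Implicit Types f g : T -> R[i].

Definition cmeasurable f := measurable_fun setT (fun w => complex.Re (f w)) /\
  measurable_fun setT (fun w => complex.Im (f w)).

Lemma cmeasurable_cst c : cmeasurable (fun=> c).
Proof. by split; exact: measurable_cst. Qed.

Lemma cmeasurable_real (f : T -> R) : measurable_fun setT f ->
  cmeasurable (fun w => (f w)%:C).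
Proof. by move=> mf; split => //=; exact: measurable_cst. Qed.

Lemma cmeasurableD f g : cmeasurable f -> cmeasurable g ->
  cmeasurable (fun w => f w + g w).
Proof.
move=> [f1 f2] [g1 g2]; split.
  by under eq_fun do rewrite cReD; exact: measurable_funD.
by under eq_fun do rewrite cImD; exact: measurable_funD.
Qed.

Lemma cmeasurableM f g : cmeasurable f -> cmeasurable g ->
  cmeasurable (fun w => f w * g w).
Proof.
move=> [f1 f2] [g1 g2]; split.
  by under eq_fun do rewrite cReM; apply: measurable_funB; exact: measurable_funM.
by under eq_fun do rewrite cImM; apply: measurable_funD; exact: measurable_funM.
Qed.

Lemma cmeasurable_conj f : cmeasurable f -> cmeasurable (fun w => (f w)^*).
Proof.
move=> [f1 f2]; split; first by under eq_fun do rewrite cReJ.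
by under eq_fun do rewrite cImJ; exact: measurableT_comp.
Qed.

Lemma cmeasurable_sum I (r : seq I) (F : I -> T -> R[i]) :
  (forall i, cmeasurable (F i)) -> cmeasurable (fun w => \sum_(i <- r) F i w).
Proof.
move=> mF; split.
  by under eq_fun do rewrite cRe_sum; apply: measurable_sum => i; case: (mF i).
by under eq_fun do rewrite cIm_sum; apply: measurable_sum => i; case: (mF i).
Qed.

Lemma cmeasurable_prod I (r : seq I) (F : I -> T -> R[i]) :
  (forall i, cmeasurable (F i)) -> cmeasurable (fun w => \prod_(i <- r) F i w).
Proof.
move=> mF; elim: r => [|i r ih].
  by under eq_fun do rewrite big_nil; exact: cmeasurable_cst.
by under eq_fun do rewrite big_cons; exact: cmeasurableM.
Qed.

(** [powR _ (-1)] is measurable on the whole line and, like the inverse, vanishes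
    at 0. *)
Lemma cmeasurableV f : cmeasurable f -> cmeasurable (fun w => (f w)^-1).
Proof.
move=> mf; under eq_fun do rewrite invc_conjE.
apply: cmeasurableM; last exact: cmeasurable_conj.
case: mf => f1 f2; apply: cmeasurable_real.
under eq_fun do rewrite -powR_inv1 ?addr_ge0 ?sqr_ge0//.
apply: (measurableT_comp (f := @powR R ^~ (-1))); first exact: measurable_powR.
by apply: measurable_funD; apply: measurable_funX.
Qed.

Lemma measurable_normc_sqr f : cmeasurable f ->
  measurable_fun setT (fun w => normc (f w) ^+ 2).
Proof.
move=> [f1 f2]; under eq_fun do rewrite normc_sqr.
by apply: measurable_funD; exact: measurable_funX.
Qed.

Lemma cmeasurable_det n (B : T -> 'M[R[i]]_n) :
  (forall i j, cmeasurable (fun w => B w i j)) -> cmeasurable (fun w => \det (B w)).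
Proof.
move=> mB; apply: cmeasurable_sum => s; apply: cmeasurableM.
  exact: cmeasurable_cst.
exact: cmeasurable_prod.
Qed.

Lemma cmeasurable_invmx n (B : T -> 'M[R[i]]_n) :
  (forall w, B w \in unitmx) -> (forall i j, cmeasurable (fun w => B w i j)) ->
  forall i j, cmeasurable (fun w => invmx (B w) i j).
Proof.
move=> uB mB i j; under eq_fun do rewrite /invmx uB !mxE.
apply: cmeasurableM; first by apply: cmeasurableV; exact: cmeasurable_det.
apply: cmeasurableM; first exact: cmeasurable_cst.
apply: cmeasurable_det => k l.
by under eq_fun do rewrite !mxE.
Qed.

Lemma cmeasurable_mulmx m n p (B : T -> 'M[R[i]]_(m, n)) (C : T -> 'M[R[i]]_(n, p)) :
  (forall i j, cmeasurable (fun w => B w i j)) ->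
  (forall i j, cmeasurable (fun w => C w i j)) ->
  forall i j, cmeasurable (fun w => (B w *m C w) i j).
Proof.
move=> mB mC i j; under eq_fun do rewrite mxE.
by apply: cmeasurable_sum => k; exact: cmeasurableM.
Qed.

End MeasurableComplex.

(** * Resolvents of real symmetric matrices *)
Section Resolvent.
Context {R : realType} (N : nat) (z : R[i]).
Implicit Types A X : 'M[R]_N.
Let y := complex.Im z.
Hypothesis y0 : 0 < y.

Definition resolvent A : 'M[R[i]]_N := invmx (map_mx (real_complex R) A - z%:M).

(** Split [u (A - z)] as [u (A - Re z) - i y u]: since [A - Re z] is symmetric, the
    cross terms cancel in the squared norm.  This coercivity is the only spectral
    information on [A] behind all the resolvent bounds. *)
Lemma sum_normc_sqr_shift A (u : 'rV[R[i]]_N) : A^T = A ->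
  y ^+ 2 * \sum_j normc (u 0 j) ^+ 2 <=
  \sum_j normc ((u *m (map_mx (real_complex R) A - z%:M)) 0 j) ^+ 2.
Proof.
move=> symA.
pose a j := complex.Re (u 0 j); pose b j := complex.Im (u 0 j).
pose al j := \sum_k a k * A k j - complex.Re z * a j.
pose be j := \sum_k b k * A k j - complex.Re z * b j.
have vE j : normc ((u *m (map_mx (real_complex R) A - z%:M)) 0 j) ^+ 2 =
    (al j ^+ 2 + be j ^+ 2) + y ^+ 2 * normc (u 0 j) ^+ 2 +
    2 * y * (al j * b j - be j * a j).
  rewrite !normc_sqr mulmxBr mul_mx_scalar !mxE cReD cImD cReN cImN cReM cImM cRe_sum cIm_sum.
  rewrite -/(a j) -/(b j) -/y /al /be.
  rewrite (eq_bigr (fun k => a k * A k j)); last first.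
    by move=> k _; rewrite !mxE cReM /= mulr0 subr0.
  rewrite [in X in _ + X = _](eq_bigr (fun k => b k * A k j)); last first.
    by move=> k _; rewrite !mxE cImM /= mulr0 add0r.
  by ring.
under [leRHS]eq_bigr do rewrite vE.
rewrite !big_split/= -!mulr_sumr.
have -> : \sum_j (al j * b j - be j * a j) = 0.
  rewrite sumrB; apply/eqP; rewrite subr_eq0; apply/eqP.
  transitivity (\sum_j (\sum_k a k * A k j) * b j - \sum_j complex.Re z * a j * b j).
    by rewrite -sumrB; apply: eq_bigr => j _; rewrite mulrBl.
  transitivity (\sum_j (\sum_k b k * A k j) * a j - \sum_j complex.Re z * a j * b j); last first.
    by rewrite -sumrB; apply: eq_bigr => j _; rewrite mulrBl; ring.
  congr (_ - _); under eq_bigr do rewrite mulr_suml.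
  rewrite exchange_big/=; apply: eq_bigr => j _; rewrite mulr_suml.
  by apply: eq_bigr => k _; rewrite -{1}symA mxE; ring.
rewrite mulr0 addr0 lerDr addr_ge0// sumr_ge0// => j _; exact: sqr_ge0.
Qed.

Lemma shift_unitmx A : A^T = A -> map_mx (real_complex R) A - z%:M \in unitmx.
Proof.
move=> symA; rewrite -row_free_unit -kermx_eq0; apply/rowV0P => u /sub_kermxP uA.
have := sum_normc_sqr_shift u symA; rewrite uA.
under [leRHS]eq_bigr do rewrite mxE normc0 expr0n.
rewrite sumr_const mul0rn pmulr_rle0 ?exprn_gt0// => u0.
have {}u0 : \sum_j normc (u 0 j) ^+ 2 = 0.
  by apply/eqP; rewrite eq_le u0 sumr_ge0// => j _; exact: sqr_ge0.
apply/matrixP => i j; rewrite ord1 mxE; apply: eq0_normc; apply/eqP.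
rewrite -sqrf_eq0; apply/eqP.
by apply: (psumr_eq0P _ u0) => // k _; exact: sqr_ge0.
Qed.

Lemma mulmx_resolvent A : A^T = A ->
  map_mx (real_complex R) A *m resolvent A = 1%:M + z *: resolvent A.
Proof.
move=> symA; rewrite -[X in X *m _](subrK z%:M) mulmxDl mulmxV ?shift_unitmx//.
by rewrite mul_scalar_mx.
Qed.

Lemma tr_resolvent A : A^T = A -> (resolvent A)^T = resolvent A.
Proof.
by move=> symA; rewrite trmx_inv linearB/= tr_scalar_mx map_trmx symA.
Qed.

(** The [i]-th row [u] of the resolvent satisfies [u (A - z) = e_i], a vector of
    norm 1. *)
Lemma sum_normc_sqr_resolvent A i : A^T = A ->
  \sum_j normc (resolvent A i j) ^+ 2 <= y ^- 2.
Proof.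
move=> symA; have := sum_normc_sqr_shift (row i (resolvent A)) symA.
rewrite -row_mul mulVmx ?shift_unitmx//.
have -> : \sum_j normc ((row i 1%:M : 'rV[R[i]]_N) 0 j) ^+ 2 = 1.
  rewrite (bigD1 i)//= big1 ?addr0; first by rewrite !mxE eqxx normc1 expr1n.
  by move=> j ji; rewrite !mxE eq_sym (negbTE ji) normc0 expr0n.
rewrite mulrC -ler_pdivlMr ?exprn_gt0// div1r.
by under eq_bigr do rewrite mxE.
Qed.

Lemma normc_resolvent A i j : A^T = A -> normc (resolvent A i j) <= y^-1.
Proof.
move=> symA; have yV0 : 0 <= y^-1 by rewrite invr_ge0 ltW.
rewrite -ler_sqr ?nnegrE ?normc_ge0// exprVn.
apply: le_trans (sum_normc_sqr_resolvent i symA).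
by rewrite (bigD1 j)//= lerDl sumr_ge0// => k _; exact: sqr_ge0.
Qed.

Lemma sum_normc_mul_resolvent A i j : A^T = A ->
  \sum_k normc (resolvent A i k) * normc (resolvent A k j) <= y ^- 2.
Proof.
move=> symA.
have h k : normc (resolvent A i k) * normc (resolvent A k j) <=
    2^-1 * normc (resolvent A i k) ^+ 2 + 2^-1 * normc (resolvent A j k) ^+ 2.
  have -> : resolvent A k j = resolvent A j k by rewrite -[in LHS](tr_resolvent symA) mxE.
  set p := normc _; set q := normc _; have := sqr_ge0 (p - q); rewrite sqrrB; lra.
apply: (le_trans (ler_sum _ (fun k _ => h k))); rewrite big_split/= -!mulr_sumr.
have := sum_normc_sqr_resolvent i symA; have := sum_normc_sqr_resolvent j symA.
lra.
Qed.

(** Replaces differentiation of the inverse: the increment is exact, and using it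
    twice gives a second-order remainder. *)
Lemma resolvent_identity A B : A^T = A -> B^T = B ->
  resolvent B - resolvent A =
  - (resolvent B *m map_mx (real_complex R) (B - A) *m resolvent A).
Proof.
move=> symA symB; rewrite map_mxB.
rewrite (_ : map_mx (real_complex R) B - map_mx (real_complex R) A =
   (map_mx (real_complex R) B - z%:M) -
   (map_mx (real_complex R) A - z%:M)); last first.
  by rewrite opprB addrA subrK.
rewrite mulmxBr mulmxBl mulVmx ?shift_unitmx// mul1mx -mulmxA mulmxV ?shift_unitmx//.
by rewrite mulmx1 opprB.
Qed.

End Resolvent.

(** * Integration against a measure with a density *)
Section Density.
Local Open Scope ereal_scope.
Context d (T : measurableType d) (R : realType).
Variables mu nu : {measure set T -> \bar R}.
Variables (D : set T) (h : T -> R).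
Hypothesis mD : measurable D.
Hypothesis mh : measurable_fun setT h.
Hypothesis h0 : forall x, (0 <= h x)%R.
Hypothesis nuE : forall B, measurable B -> nu B = \int[mu]_(x in B `&` D) (h x)%:E.

Import HBNNSimple.

Let ge0_integral_density_nnsfun (f : {nnsfun T >-> R}) :
  \int[nu]_x (f x)%:E = \int[mu]_(x in D) ((f x)%:E * (h x)%:E).
Proof.
under eq_integral do rewrite fimfunE -fsumEFin//.
rewrite ge0_integral_fsum//; last 2 first.
  - by move=> r; apply/measurable_EFinP/measurable_funM => //; exact: measurable_cst.
  - by move=> r x _; rewrite EFinM nnfun_muleindic_ge0.
have mhD : measurable_fun D (EFin \o h) by apply/measurable_EFinP/measurable_funTS.
have mi r : measurable_fun D (fun x => (r * \1_(f @^-1` [set r]) x)%:E).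
  apply/measurable_EFinP/measurable_funM; first exact: measurable_cst.
  exact: measurable_funTS.
have fi0 r x : 0 <= (r * \1_(f @^-1` [set r]) x)%:E.
  by rewrite EFinM nnfun_muleindic_ge0.
transitivity (\sum_(r \in range f)
    \int[mu]_(x in D) ((r * \1_(f @^-1` [set r]) x)%:E * (h x)%:E)).
  apply: eq_fsbigr => r /set_mem[x _ fxr].
  have r0 : (0 <= r)%R by rewrite -fxr.
  rewrite integralZl_indic_nnsfun// integral_indic//.
  rewrite setIT nuE// setIC integral_mkcondr.
  under [RHS]eq_integral do rewrite EFinM -muleA.
  rewrite ge0_integralZl//; last 2 first.
    - apply: emeasurable_funM => //.
      by apply/measurable_EFinP/measurable_funTS; exact: measurable_indic.
    - by move=> y _; rewrite mule_ge0// lee_fin.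
  congr (_ * _); apply: eq_integral => y _.
  rewrite patchE indicE; case: ifPn => _; first by rewrite mul1e.
  by rewrite mul0e.
rewrite -ge0_integral_fsum//; last 2 first.
  - by move=> r; exact: emeasurable_funM.
  - by move=> r x _; rewrite mule_ge0// lee_fin.
apply: eq_integral => x _.
by rewrite -ge0_mule_fsuml// fsumEFin// -fimfunE.
Qed.

Lemma ge0_integral_density (f : T -> \bar R) :
  measurable_fun setT f -> (forall x, 0 <= f x) ->
  \int[nu]_x f x = \int[mu]_(x in D) (f x * (h x)%:E).
Proof.
move=> mf f0; pose f_ := nnsfun_approx measurableT mf.
have mhD : measurable_fun D (EFin \o h) by apply/measurable_EFinP/measurable_funTS.
transitivity (limn (fun n => \int[nu]_x (f_ n x)%:E)).
  rewrite -monotone_convergence//.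
  - apply: eq_integral => x _; apply/esym/cvg_lim => //.
    exact: cvg_nnsfun_approx.
  - by move=> n; exact/measurable_EFinP.
  - by move=> n x _; rewrite lee_fin.
  - by move=> x _ a b ab; rewrite lee_fin; exact/lefP/nd_nnsfun_approx.
under eq_fun do rewrite ge0_integral_density_nnsfun.
rewrite -monotone_convergence//.
- apply: eq_integral => x _; apply/cvg_lim => //.
  apply: cvgeZr => //.
  exact: cvg_nnsfun_approx.
- by move=> n; apply: emeasurable_funM => //; exact/measurable_EFinP/measurable_funTS.
- by move=> n x _; rewrite mule_ge0// lee_fin.
- move=> x _ a b ab; rewrite lee_wpmul2r ?lee_fin//.
  exact/lefP/nd_nnsfun_approx.
Qed.

End Density.

(** * Translation invariance of Lebesgue measure on tuples *)
Section Translation.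
Context {R : realType}.
Local Open Scope ereal_scope.

Lemma lebesgue_measure_translation (a : R) (B : set (measurableTypeR R)) :
  measurable B ->
  lebesgue_measure [set x : R | B (x + a)%R] = lebesgue_measure B :> \bar R.
Proof.
have ma : measurable_fun setT (fun x : measurableTypeR R => x + a : measurableTypeR R)%R.
  exact: measurable_funD.
move=> mB.
pose mua : {measure set (measurableTypeR R) -> \bar R} :=
  pushforward (@lebesgue_measure R : {measure set _ -> \bar R})
    (fun x : measurableTypeR R => x + a : measurableTypeR R)%R.
apply/esym.
rewrite -[RHS]/(mua ma B); move: B mB; apply: lebesgue_measure_unique => _ [[b c]] _ <-.
rewrite /mua /= /pushforward.
rewrite (_ : _ @^-1` _ = `](b - a)%R, (c - a)%R]%classic); last first.
  by apply/seteqP; split => x /=; rewrite !in_itv/= ltrBlDr lerBrDr.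
rewrite !lebesgue_measure_itv/= !lte_fin ltrD2r.
by case: ifPn => // _; rewrite -!EFinB opprB addrA subrK.
Qed.

Definition tuple_shift n (s x : n.-tuple (measurableTypeR R)) :
  n.-tuple (measurableTypeR R) := [tuple (tnth x i + tnth s i)%R | i < n].

Lemma measurable_tuple_shift n (s : n.-tuple (measurableTypeR R)) :
  measurable_fun setT (tuple_shift s).
Proof.
apply/measurable_fun_tnthP => i.
rewrite (_ : _ \o _ = (fun x => tnth x i + tnth s i)%R); last first.
  by apply/funext => x /=; rewrite tnth_mktuple.
by apply: measurable_funD => //; exact: measurable_tnth.
Qed.

Lemma tuple_shift_cons n (s x : n.-tuple (measurableTypeR R)) (a t : R) :
  tuple_shift [tuple of a :: s] [tuple of t :: x] =
  [tuple of (t + a)%R :: tuple_shift s x].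
Proof.
apply: eq_from_tnth => i; rewrite tnth_mktuple.
by case: (unliftP ord0 i) => [j|] ->; rewrite ?tnthS ?tnth0 // tnth_mktuple.
Qed.

(** By Fubini on the head coordinate: the inner integral is invariant by the
    one-dimensional case, the outer one by induction. *)
Lemma lebesgue_tuple_translation n (s : n.-tuple (measurableTypeR R))
    (B : set (n.-tuple (measurableTypeR R))) : measurable B ->
  lebesgue_tuple n (tuple_shift s @^-1` B) = lebesgue_tuple n B.
Proof.
elim: n s B => [|n ih] s B mB.
  congr (_ _); apply/seteqP; split => x /=; rewrite [tuple_shift _ _]tuple0 [x]tuple0//.
case/tupleP: s => a s.
have mcons := @measurable_tuple_cons R n.
pose L : set (measurableTypeR R) -> \bar R := lebesgue_measure.
pose slice := fun x : n.-tuple (measurableTypeR R) =>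
  L [set t : measurableTypeR R | B [tuple of t :: x]].
have sliceE C : lebesgue_tuple n.+1 C =
    \int[lebesgue_tuple n]_x L [set t : measurableTypeR R | C [tuple of t :: x]].
  rewrite /= /lebesgue_tuple_rec /pushforward /product_measure1.
  apply: eq_integral => x _; rewrite /L /=; congr (_ _).
  by apply/seteqP; split => t /=; rewrite /xsection /= inE.
have mBc : measurable (@tuple_cons R n @^-1` B) by rewrite -[X in measurable X]setTI; exact: mcons.
have mslice : measurable_fun setT slice.
  rewrite (_ : slice = L \o xsection (@tuple_cons R n @^-1` B)); last first.
    apply/funext => x; rewrite /slice /=; congr (_ _).
    by apply/seteqP; split => t /=; rewrite /xsection /= inE.
  exact: (measurable_fun_xsection (@lebesgue_measure R)).
rewrite !sliceE.
transitivity (\int[lebesgue_tuple n]_x slice (tuple_shift s x)).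
  apply: eq_integral => x _.
  rewrite /slice /L -[RHS](lebesgue_measure_translation a)//; last first.
    rewrite (_ : [set t : measurableTypeR R | _] =
      xsection (@tuple_cons R n @^-1` B) (tuple_shift s x)).
      exact: measurable_xsection.
    by apply/seteqP; split => t /=; rewrite /xsection /= inE.
  congr (_ _); apply/seteqP; split => t /=; by rewrite tuple_shift_cons.
have mshift := measurable_tuple_shift s.
rewrite -[LHS](@ge0_integral_pushforward _ _ _ _ _ _ mshift _ setT slice)//.
by apply: eq_measure_integral => C mC _; exact: ih.
Qed.

End Translation.

(** * The coordinates of symmetric matrices *)
Section SymMx.
Context {R : realType}.
Implicit Types N : nat.

Lemma upper_coordsK N (A : 'M[R]_N) : A^T = A -> sym_mx (upper_coords A) = A.
Proof.
move=> symA; apply/matrixP => i j; rewrite mxE /=.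
have nthE (p : 'I_N * 'I_N) : (p.1 <= p.2)%N ->
    [seq A q.1 q.2 | q <- upper_pairs N]`_(index p (upper_pairs N)) = A p.1 p.2.
  move=> lep; have pin : p \in upper_pairs N by rewrite mem_filter lep mem_enum.
  by rewrite (nth_map p) ?index_mem// nth_index.
case: leqP => [ij|/ltnW ji]; rewrite nthE//.
by rewrite -{1}symA mxE.
Qed.

Lemma tr_sym_mx N x : (@sym_mx R N x)^T = sym_mx x.
Proof.
apply/matrixP => i j; rewrite !mxE.
by case: (ltngtP i j) => // /val_inj ->.
Qed.

Lemma sym_mxD N s x : @sym_mx R N (tuple_shift s x) = sym_mx x + sym_mx s.
Proof.
apply/matrixP => i j; rewrite !mxE.
set k := index _ _; have [kn|kn] := ltnP k (size (upper_pairs N)).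
  by have := tnth_mktuple (fun i => tnth x i + tnth s i) (Ordinal kn);
    rewrite !(tnth_nth 0).
by rewrite !nth_default ?addr0// size_tuple.
Qed.

Lemma measurable_sym_mx N (i j : 'I_N) :
  measurable_fun setT (fun x => @sym_mx R N x i j).
Proof.
under eq_fun do rewrite mxE.
set k := index _ _; have [kn|kn] := ltnP k (size (upper_pairs N)).
  under eq_fun do rewrite -(tnth_nth 0 _ (Ordinal kn)).
  exact: measurable_tnth.
under eq_fun do rewrite nth_default ?size_tuple//.
exact: measurable_cst.
Qed.

Lemma measurable_mxtrace_mul d (T : measurableType d) N (B C : T -> 'M[R]_N) :
  (forall i j, measurable_fun setT (fun w => B w i j)) ->
  (forall i j, measurable_fun setT (fun w => C w i j)) ->
  measurable_fun setT (fun w => \tr (B w *m C w)).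
Proof.
move=> mB mC; apply: measurable_sum => i.
under eq_fun do rewrite mxE.
by apply: measurable_sum => j; apply: measurable_funM.
Qed.

End SymMx.

(** * Shifting a GOE matrix *)
Section GOEShift.
Context {R : realType} d (T : measurableType d) (P : probability T R) (N : nat).
Variable A : T -> 'M[R]_N.
Hypothesis hA : GOE P A.

Let symA w : (A w)^T = A w. Proof. by case: hA. Qed.
Let mA i j : measurable_fun setT (fun w => A w i j). Proof. by case: hA. Qed.

Let coords w := upper_coords (A w).

Let mcoords : measurable_fun setT coords.
Proof.
apply/measurable_fun_tnthP => i.
rewrite (_ : _ \o _ = (fun w => A w (tnth (in_tuple (upper_pairs N)) i).1
   (tnth (in_tuple (upper_pairs N)) i).2)); first exact: mA.
by apply/funext => w /=; rewrite tnth_map.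
Qed.

(** A GOE matrix is symmetric at every sample point, so it factors through its
    coordinates; measurability in terms of coordinates is all that is ever
    required of a test function. *)
Lemma GOE_measurable_fun (f : 'M[R]_N -> R) :
  measurable_fun setT (fun x => f (sym_mx x)) ->
  measurable_fun setT (fun w => f (A w)).
Proof.
move=> mf; rewrite (_ : (fun w => _) = (fun x => f (sym_mx x)) \o coords).
  exact: measurableT_comp.
by apply/funext => w /=; rewrite upper_coordsK.
Qed.

Definition GOE_potential (X : 'M[R]_N) : R := N%:R / 4 * \tr (X *m X).

Let V := GOE_potential.

(** The constant is nonnegative because the total mass 1 is its product with a
    nonnegative integral. *)
Let GOE_integral : exists2 c : R, 0 <= c & forall f : 'M[R]_N -> R,
  measurable_fun setT (fun x => f (sym_mx x)) ->
  (forall X, X^T = X -> 0 <= f X) ->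
  (\int[P]_w (f (A w))%:E = \int[lebesgue_tuple (size (upper_pairs N))]_x
     (f (sym_mx x) * (c * expR (- V (sym_mx x))))%:E)%E.
Proof.
have [_ _ [c cP]] := hA.
have mV : measurable_fun setT (fun x => expR (- V (sym_mx x))).
  apply: measurableT_comp => //; apply: measurableT_comp => //.
  apply: measurable_funM; first exact: measurable_cst.
  by apply: measurable_mxtrace_mul => i j; exact: measurable_sym_mx.
have VE x : - V (sym_mx x) = - (N%:R / 4) * \tr (sym_mx x *m sym_mx x).
  by rewrite /V /GOE_potential mulNr.
have c0 : 0 <= c.
  rewrite leNgt; apply/negP => c0.
  have := cP setT measurableT; rewrite (_ : [set w | _] = setT); last first.
    by apply/seteqP; split.
  rewrite probability_setT => /esym/eqP; rewrite lt_eqF//.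
  apply: (@le_lt_trans _ _ 0%E); last by rewrite lte_fin.
  rewrite mule_le0_ge0//; first by rewrite lee_fin ltW.
  by apply: integral_ge0 => x _; rewrite lee_fin expR_ge0.
exists c => // f mf f0.
pose nu : {measure set _ -> \bar R} := pushforward P coords.
pose phi x := (f (sym_mx x))%:E.
have mphi : measurable_fun setT phi by exact/measurable_EFinP.
have phi0 x : (0 <= phi x)%E by rewrite lee_fin f0// tr_sym_mx.
transitivity (\int[nu mcoords]_x phi x)%E.
  rewrite ge0_integral_pushforward//.
  by apply: eq_integral => w _; rewrite /phi /= upper_coordsK.
rewrite (@ge0_integral_density _ _ R (lebesgue_tuple (size (upper_pairs N))) _ setT
   (fun x => c * expR (- V (sym_mx x))))//.
- exact: measurable_funM.
- by move=> x; rewrite mulr_ge0// expR_ge0.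
- move=> B mB; rewrite setIT /nu /= /pushforward.
  have := cP B mB; rewrite /preimage /coords => ->.
  rewrite -ge0_integralZl//.
  + by apply: eq_integral => x _; rewrite -EFinM -VE.
  + by apply/measurable_EFinP; apply: measurable_funTS; under eq_fun do rewrite -VE.
Qed.

(** The Cameron-Martin formula before expanding the potential: change variables
    by a translation in the integral against the density. *)
Lemma GOE_shift (S : 'M[R]_N) (f : 'M[R]_N -> R) : S^T = S ->
  measurable_fun setT (fun x => f (sym_mx x)) ->
  (forall X, X^T = X -> 0 <= f X) ->
  (\int[P]_w (f (A w + S)%R * expR (V (A w) - V (A w + S)%R)%R)%:E =
   \int[P]_w (f (A w))%:E)%E.
Proof.
move=> symS mf f0; have [c c0 cP] := GOE_integral.
have addS x : sym_mx x + S = sym_mx (tuple_shift (upper_coords S) x).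
  by rewrite sym_mxD upper_coordsK.
have mshift := measurable_tuple_shift (upper_coords S).
have mVx : measurable_fun setT (fun x => V (sym_mx x)).
  apply: measurable_funM; first exact: measurable_cst.
  by apply: measurable_mxtrace_mul => i j; exact: measurable_sym_mx.
rewrite (cP (fun X => f (X + S) * expR (V X - V (X + S)))); last 2 first.
- under eq_fun do rewrite addS.
  apply: measurable_funM; first exact: (measurableT_comp mf).
  apply: measurableT_comp => //; apply: measurable_funB => //.
  exact: (measurableT_comp mVx).
- by move=> X symX; rewrite mulr_ge0 ?expR_ge0// f0// linearD/= symX symS.
rewrite cP//.
pose F x := (f (sym_mx x) * (c * expR (- V (sym_mx x))))%:E.
transitivity (\int[lebesgue_tuple (size (upper_pairs N))]_x
    (F (tuple_shift (upper_coords S) x)))%E.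
  apply: eq_integral => x _; rewrite /F -addS; congr (_%:E).
  set a := V (sym_mx x); set b := V _.
  have -> : expR (- b) = expR (a - b) * expR (- a) by rewrite -expRD; congr expR; ring.
  by ring.
have mF : measurable_fun setT F.
  apply/measurable_EFinP/measurable_funM => //.
  apply: measurable_funM => //; apply: measurableT_comp => //.
  exact: measurableT_comp.
rewrite -[LHS](@ge0_integral_pushforward _ _ _ _ _ _ mshift _ setT F)//.
  by apply: eq_measure_integral => C mC _; exact: lebesgue_tuple_translation.
by move=> x _; rewrite lee_fin mulr_ge0 ?f0 ?tr_sym_mx// mulr_ge0 ?expR_ge0.
Qed.

End GOEShift.

(** * Integrability of real random variables *)
Section RealIntegrable.
Context d (T : measurableType d) {R : realType} (P : probability T R).
Implicit Types f g : T -> R.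

Lemma integrable_dominated f g : measurable_fun setT f ->
  (forall w, `|f w| <= g w) -> P.-integrable setT (EFin \o g) ->
  P.-integrable setT (EFin \o f).
Proof.
move=> mf fg; apply: le_integrable => //; first exact/measurable_EFinP.
by move=> w _ /=; rewrite lee_fin (le_trans (fg w))// ler_norm.
Qed.

Lemma integrable_bounded f C : measurable_fun setT f ->
  (forall w, `|f w| <= C) -> P.-integrable setT (EFin \o f).
Proof.
move=> mf fC; apply: (@integrable_dominated _ (cst C)) => //.
exact: finite_measure_integrable_cst.
Qed.

Lemma integrable_realD f g : P.-integrable setT (EFin \o f) ->
  P.-integrable setT (EFin \o g) -> P.-integrable setT (EFin \o (fun w => f w + g w)).
Proof. by move=> fi gi; have := integrableD measurableT fi gi. Qed.

Lemma integrable_realB f g : P.-integrable setT (EFin \o f) ->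
  P.-integrable setT (EFin \o g) -> P.-integrable setT (EFin \o (fun w => f w - g w)).
Proof. by move=> fi gi; have := integrableB measurableT fi gi. Qed.

Lemma integrable_realZ k f : P.-integrable setT (EFin \o f) ->
  P.-integrable setT (EFin \o (fun w => k * f w)).
Proof. by move=> fi; have := integrableZl measurableT k fi. Qed.

Lemma integrable_real_measurable f : P.-integrable setT (EFin \o f) ->
  measurable_fun setT f.
Proof. by move/measurable_int/measurable_EFinP. Qed.

End RealIntegrable.

(** * Taylor bounds for the exponential *)
Section ExpBounds.
Context {R : realType}.
Implicit Types x : R.

Lemma expRB1_le x : expR x - 1 <= x * expR x.
Proof.
have := expR_ge1Dx (- x); have := expR_gt0 x; rewrite expRN => e0.
move=> /(ler_wpM2l (ltW e0)); rewrite mulfV ?gt_eqF//; lra.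
Qed.

Lemma normr_expRB1_le x : `|expR x - 1| <= `|x| * expR `|x|.
Proof.
have e1 := expR_ge1Dx x; have [x0|x0] := leP 0 x.
  by rewrite (ger0_norm x0) ger0_norm ?expRB1_le//; lra.
have : 1 <= expR (- x) by rewrite -expR0 ler_expR; lra.
have : expR x <= 1 by rewrite -expR0 ler_expR; lra.
rewrite (ltr0_norm x0) ler_norml => ? /(@ler_wpM2l _ (- x)).
rewrite oppr_ge0 ltW// => /(_ isT) ?; apply/andP; split; lra.
Qed.

Lemma normr_expRB1B_le x : `|expR x - 1 - x| <= x ^+ 2 * expR `|x|.
Proof.
have := expR_ge1Dx x => e1; rewrite ger0_norm ?subr_ge0; last lra.
have h1 : expR x - 1 - x <= x * (expR x - 1) by have := expRB1_le x; lra.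
apply: (le_trans h1); apply: (le_trans (ler_norm _)); rewrite normrM.
rewrite -real_normK ?num_real// expr2 -mulrA ler_wpM2l//.
exact: normr_expRB1_le.
Qed.

End ExpBounds.

(** * Gaussian integration by parts *)
Section GOEStein.
Context {R : realType} d (T : measurableType d) (P : probability T R) (N : nat).
Variable A : T -> 'M[R]_N.
Hypothesis hA : GOE P A.
Variable D : 'M[R]_N.
Hypothesis symD : D^T = D.

Let symA w : (A w)^T = A w. Proof. by case: hA. Qed.

(** The first and second order coefficients in [t] of the potential at
    [X + t *: D]. *)
Let slope (X : 'M[R]_N) : R := N%:R / 2 * \tr (X *m D).
Let curv : R := N%:R / 4 * \tr (D *m D).

Let curv_ge0 : 0 <= curv.
Proof.
apply: mulr_ge0; first by rewrite divr_ge0.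
apply: sumr_ge0 => i _; rewrite mxE; apply: sumr_ge0 => j _.
by rewrite -{1}symD mxE -expr2 sqr_ge0.
Qed.

Let potential_shift X t : GOE_potential X - GOE_potential (X + t *: D) =
  - (t * slope X) - t ^+ 2 * curv.
Proof.
rewrite /GOE_potential /slope /curv mulmxDl !mulmxDr !mxtraceD.
rewrite -scalemxAr -!scalemxAl -scalemxAr !mxtraceZ [\tr (D *m X)]mxtrace_mulC.
by field.
Qed.

Let mslope : measurable_fun setT (fun x => slope (sym_mx x)).
Proof.
apply: measurable_funM; first exact: measurable_cst.
apply: measurable_mxtrace_mul => i j; first exact: measurable_sym_mx.
exact: measurable_cst.
Qed.

Let mslopeA : measurable_fun setT (fun w => slope (A w)).
Proof. exact: (GOE_measurable_fun hA (f := slope)). Qed.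

Let symAD t w : (A w + t *: D)^T = A w + t *: D.
Proof. by rewrite linearD linearZ/= symA symD. Qed.

Let mshift (f : 'M[R]_N -> R) t : measurable_fun setT (fun x => f (sym_mx x)) ->
  measurable_fun setT (fun x => f (sym_mx x + t *: D)).
Proof.
move=> mf.
have symtD : (t *: D)^T = t *: D by rewrite linearZ/= symD.
rewrite (_ : (fun _ => _) =
  (fun x => f (sym_mx x)) \o tuple_shift (upper_coords (t *: D))).
  by apply: (measurableT_comp mf); exact: measurable_tuple_shift.
by apply/funext => x /=; rewrite sym_mxD upper_coordsK.
Qed.

Let ge0_cameron_martin (f : 'M[R]_N -> R) t :
  measurable_fun setT (fun x => f (sym_mx x)) ->
  (forall X, X^T = X -> 0 <= f X) ->
  (\int[P]_w (f (A w + t *: D)%R * expR (- (t * slope (A w))))%:E =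
   (expR (t ^+ 2 * curv))%:E * \int[P]_w (f (A w))%:E)%E.
Proof.
move=> mf f0.
have symtD : (t *: D)^T = t *: D by rewrite linearZ/= symD.
rewrite -(GOE_shift hA symtD mf f0) -ge0_integralZl//.
- apply: eq_integral => w _; rewrite potential_shift -EFinM; congr (_%:E).
  rewrite [RHS]mulrCA -expRD; congr (_ * expR _); ring.
- apply/measurable_EFinP.
  under eq_fun do rewrite potential_shift.
  apply: (GOE_measurable_fun hA
    (f := fun X => f (X + t *: D) * expR (- (t * slope X) - t ^+ 2 * curv))).
  apply: measurable_funM; first exact: mshift.
  apply: measurableT_comp => //; apply: measurable_funB; last exact: measurable_cst.
  apply: measurableT_comp => //; apply: measurable_funM => //; exact: measurable_cst.
- by move=> w _; rewrite lee_fin mulr_ge0 ?expR_ge0// f0.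
Qed.

Let mexp k : measurable_fun setT (fun w => expR (k * slope (A w))).
Proof.
apply: measurableT_comp => //; apply: measurable_funM => //; exact: measurable_cst.
Qed.

(** The shift formula for the constant function 1, in direction [- k D], computes
    this exponential moment. *)
Let integrable_exp k :
  P.-integrable setT (EFin \o (fun w => expR (k * slope (A w)))).
Proof.
apply/integrableP; split; first exact/measurable_EFinP.
have := @ge0_cameron_martin (cst 1) (- k) (measurable_cst _) (fun _ _ => ler01).
under eq_integral do rewrite mul1r mulNr opprK.
move=> e; under eq_integral do rewrite /= ger0_norm ?expR_ge0//.
rewrite e (_ : (\int[P]_w _ = 1)%E) ?mule1 ?ltry//.
by rewrite [LHS](integral_cst P measurableT 1%E) mul1e; exact: probability_setT.
Qed.

Let integrable_exp_norm k : 0 <= k ->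
  P.-integrable setT (EFin \o (fun w => expR (k * `|slope (A w)|))).
Proof.
move=> k0; apply: integrable_dominated (integrable_realD (integrable_exp k) (integrable_exp (- k))).
  apply: measurableT_comp => //; apply: measurable_funM; first exact: measurable_cst.
  exact: measurableT_comp.
move=> w; rewrite ger0_norm ?expR_ge0//.
have := expR_ge0 (k * slope (A w)); have := expR_ge0 (- k * slope (A w)).
by have [] := ger0P (slope (A w)); rewrite ?mulrN -?mulNr; lra.
Qed.

(** The identity for nonnegative functions, applied to [f + C] and to [C]. *)
Let cameron_martin (f : 'M[R]_N -> R) C t :
  measurable_fun setT (fun x => f (sym_mx x)) ->
  (forall X, X^T = X -> `|f X| <= C) ->
  \int[P]_w (f (A w + t *: D) * expR (- (t * slope (A w)))) =
   expR (t ^+ 2 * curv) * \int[P]_w f (A w).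
Proof.
move=> mf fC.
have mfA := GOE_measurable_fun hA mf.
have mftA := GOE_measurable_fun hA (f := fun X => f (X + t *: D)) (mshift t mf).
have intf : P.-integrable setT (EFin \o (fun w => f (A w))).
  by apply: (@integrable_bounded _ _ _ _ _ C) => // w; rewrite fC.
have me : measurable_fun setT (fun w => expR (- (t * slope (A w)))).
  by have := mexp (- t); under eq_fun do rewrite mulNr.
have inte : P.-integrable setT (EFin \o (fun w => expR (- (t * slope (A w))))).
  by have := integrable_exp (- t); under eq_fun do rewrite mulNr.
have intfe : P.-integrable setT (EFin \o
    (fun w => f (A w + t *: D) * expR (- (t * slope (A w))))).
  apply: integrable_dominated (integrable_realZ C inte).
    exact: measurable_funM.
  by move=> w; rewrite normrM (ger0_norm (expR_ge0 _)) ler_wpM2r ?expR_ge0// fC.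
have C0 : 0 <= C by apply: le_trans (fC 0 _); rewrite ?trmx0.
have intC : P.-integrable setT (EFin \o (fun=> C) : T -> \bar R).
  exact: finite_measure_integrable_cst.
have CM (u : 'M[R]_N -> R) : measurable_fun setT (fun x => u (sym_mx x)) ->
    (forall X, X^T = X -> 0 <= u X) ->
    P.-integrable setT (EFin \o (fun w => u (A w))) ->
    \int[P]_w (u (A w + t *: D) * expR (- (t * slope (A w)))) =
    expR (t ^+ 2 * curv) * \int[P]_w u (A w).
  move=> mu u0 intu; rewrite /Rintegral ge0_cameron_martin// fineM//.
  exact: integrable_fin_num.
have intCe := integrable_realZ C inte.
have hD : \int[P]_w ((f (A w + t *: D) + C) * expR (- (t * slope (A w)))) =
    \int[P]_w (f (A w + t *: D) * expR (- (t * slope (A w)))) +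
    \int[P]_w (C * expR (- (t * slope (A w)))).
  by rewrite -RintegralD//; apply: eq_Rintegral => w _; rewrite mulrDl.
have hC := CM (cst C) (measurable_cst _) (fun _ _ => C0) intC.
have := CM (fun X => f X + C); rewrite hD hC RintegralD// => h.
apply: (addIr (expR (t ^+ 2 * curv) * \int[P]_w C)).
rewrite -mulrDr; apply: h.
- exact: measurable_funD.
- by move=> X symX; have := fC X symX; rewrite ler_norml => /andP[]; lra.
- exact: integrable_realD.
Qed.

(** Gaussian integration by parts in direction [D], with [g] the derivative of [f].
    The shift formula reads
    [E[f(A + tD) exp(- t slope(A))] = exp(t^2 curv) E[f(A)]];
    both sides are expanded at [t = 0].  The remainders are bounded by [t^2] times
    an integrable variable, so comparing the terms of order [t] gives the
    identity; no differentiation under the integral sign is involved. *)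
Lemma GOE_stein (f g : 'M[R]_N -> R) C :
  measurable_fun setT (fun x => f (sym_mx x)) ->
  measurable_fun setT (fun x => g (sym_mx x)) ->
  (forall X, X^T = X -> `|f X| <= C) ->
  (forall X, X^T = X -> `|g X| <= C) ->
  (forall X t, X^T = X -> 0 < t <= 1 ->
    `|f (X + t *: D) - f X - t * g X| <= C * t ^+ 2) ->
  P.-integrable setT (EFin \o (fun w => slope (A w) * f (A w))) /\
  \int[P]_w g (A w) = \int[P]_w (slope (A w) * f (A w)).
Proof.
move=> mf mg fC gC fgC.
have mfA := GOE_measurable_fun hA mf.
have mgA := GOE_measurable_fun hA mg.
have mftA t := GOE_measurable_fun hA (f := fun X => f (X + t *: D)) (mshift t mf).
have C0 : 0 <= C by apply: le_trans (fC 0 _); rewrite ?trmx0.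
have e1 x : x <= expR x :> R by have := expR_ge1Dx x; lra.
(* Dominates all remainders: [l^j exp l <= exp (3 l)] for [l >= 0] and [j <= 2]. *)
pose E w := expR (3 * `|slope (A w)|).
have intE : P.-integrable setT (EFin \o E) by exact: integrable_exp_norm.
have intf : P.-integrable setT (EFin \o (fun w => f (A w))).
  by apply: (@integrable_bounded _ _ _ _ _ C) => // w; rewrite fC.
have intg : P.-integrable setT (EFin \o (fun w => g (A w))).
  by apply: (@integrable_bounded _ _ _ _ _ C) => // w; rewrite gC.
have intlf : P.-integrable setT (EFin \o (fun w => slope (A w) * f (A w))).
  apply: integrable_dominated (integrable_realZ C intE).
    exact: measurable_funM.
  move=> w; rewrite normrM mulrC ler_pM// ?fC//.
  apply: (le_trans (e1 _)); rewrite ler_expR.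
  by have := normr_ge0 (slope (A w)); lra.
split => //; apply/eqP; rewrite -subr_eq0 -normr_le0 -RintegralB//.
set I := Rintegral _ _ _.
pose M := \int[P]_w E w.
have M0 : 0 <= M by apply: Rintegral_ge0 => w _; exact: expR_ge0.
pose K := 4 * C * M + C * curv * expR curv.
(* Letting [t -> 0] in this bound gives [I = 0]. *)
suff IK t : 0 < t <= 1 -> `|I| <= t * K.
  have K0 : 0 <= K.
    apply: addr_ge0; first by apply: mulr_ge0 => //; lra.
    by apply: mulr_ge0; [exact: mulr_ge0|exact: expR_ge0].
  rewrite leNgt; apply/negP => I0.
  have K1 : 0 < K + `|I| by lra.
  have := IK (`|I| / (2 * (K + `|I|))).
  rewrite divr_gt0//=; last by lra.
  rewrite ler_pdivrMr; last by lra.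
  rewrite mul1r => /(_ ltac:(lra)).
  rewrite -mulrA ler_pMr// mulrC ler_pdivlMr; last by lra.
  lra.
move=> /andP[t0 t1].
have t01 : 0 < t <= 1 by rewrite t0.
pose e w := expR (- (t * slope (A w))).
pose r w := f (A w + t *: D) * e w - f (A w) - t * (g (A w) - slope (A w) * f (A w)).
have rE w : `|r w| <= t ^+ 2 * (4 * C) * E w.
  set a := slope (A w); set b := - (t * a); set u := expR `|a|.
  have u1 : 1 <= u by rewrite -expR0 ler_expR.
  have au : `|a| <= u by exact: e1.
  have EE : E w = u ^+ 3 by rewrite /E -expRM_natl.
  have -> : r w = (f (A w + t *: D) - f (A w) - t * g (A w)) * expR b +
      f (A w) * (expR b - 1 - b) + t * g (A w) * (expR b - 1).
    by rewrite /r /e -/a -/b /b; ring.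
  have bn : `|b| = t * `|a| by rewrite normrN normrM gtr0_norm.
  have bu : expR `|b| <= u by rewrite ler_expR bn ler_piMl.
  have tu : `|b| <= t * u by rewrite bn ler_wpM2l// ltW.
  have h1 : `|(f (A w + t *: D) - f (A w) - t * g (A w)) * expR b| <= C * t ^+ 2 * u.
    rewrite normrM ler_pM// ?fgC// ger0_norm ?expR_ge0//.
    by rewrite (le_trans _ bu)// ler_expR ler_norm.
  have h2 : `|f (A w) * (expR b - 1 - b)| <= C * ((t * u) ^+ 2 * u).
    rewrite normrM ler_pM// ?fC//; apply: (le_trans (normr_expRB1B_le _)).
    by rewrite ler_pM ?sqr_ge0 ?expR_ge0// -real_normK ?num_real// ler_sqr ?nnegrE ?(le_trans _ tu).
  have h3 : `|t * g (A w) * (expR b - 1)| <= t * C * (t * u * u).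
    rewrite normrM; apply: ler_pM => //.
      by rewrite normrM gtr0_norm// ler_pM2l// gC.
    by apply: (le_trans (normr_expRB1_le _)); rewrite ler_pM ?expR_ge0.
  apply: (le_trans (ler_normD _ _)); apply: (le_trans (lerD (ler_normD _ _) (lexx _))).
  apply: (le_trans (lerD (lerD h1 h2) h3)); rewrite EE.
  have u3 : u <= u ^+ 3 by rewrite -[leLHS]expr1; exact: ler_weXn2l.
  have u23 : u ^+ 2 <= u ^+ 3 by exact: ler_weXn2l.
  have Ct0 : 0 <= C * t ^+ 2 by rewrite mulr_ge0 ?sqr_ge0.
  have := ler_wpM2l Ct0 u3; have := ler_wpM2l Ct0 u23.
  have : 0 <= C * t ^+ 2 * u ^+ 3 by rewrite mulr_ge0 ?exprn_ge0// (le_trans _ u1).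
  rewrite (_ : C * ((t * u) ^+ 2 * u) = C * t ^+ 2 * u ^+ 3); last by ring.
  rewrite (_ : t * C * (t * u * u) = C * t ^+ 2 * u ^+ 2); last by ring.
  rewrite (_ : t ^+ 2 * (4 * C) * u ^+ 3 = 4 * (C * t ^+ 2 * u ^+ 3)); last by ring.
  lra.
have me : measurable_fun setT e.
  by apply: measurableT_comp => //; apply: measurableT_comp => //; exact: measurable_funM.
have inte : P.-integrable setT (EFin \o e).
  by have := integrable_exp (- t); under eq_fun do rewrite mulNr.
have intfe : P.-integrable setT (EFin \o (fun w => f (A w + t *: D) * e w)).
  apply: integrable_dominated (integrable_realZ C inte); first exact: measurable_funM.
  by move=> w; rewrite normrM (ger0_norm (expR_ge0 _)) ler_wpM2r ?expR_ge0// fC.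
have intr : P.-integrable setT (EFin \o r).
  by do 2?apply: integrable_realB => //; apply: integrable_realZ; exact: integrable_realB.
have rI : \int[P]_w r w = (expR (t ^+ 2 * curv) - 1) * \int[P]_w f (A w) - t * I.
  rewrite RintegralB//; last 2 first.
    exact: integrable_realB.
    by apply: integrable_realZ; exact: integrable_realB.
  rewrite RintegralB// RintegralZl//; last exact: integrable_realB.
  by rewrite (cameron_martin _ mf fC) mulrBl mul1r.
have rle : `|\int[P]_w r w| <= t ^+ 2 * (4 * C) * M.
  apply: (le_trans (le_normr_Rintegral measurableT intr)).
  rewrite -RintegralZl//; apply: le_Rintegral => //; last exact: integrable_realZ.
  by apply: integrable_dominated (integrable_realZ _ intE) => //;
    [apply: measurableT_comp => //; exact: integrable_real_measurable intr
    |move=> w; rewrite normr_id; exact: rE].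
have fI : `|\int[P]_w f (A w)| <= C.
  apply: (le_trans (le_normr_Rintegral measurableT intf)).
  have -> : C = \int[P]_w C.
    rewrite Rintegral_cst// -[LHS]mulr1; congr (_ * _).
    by have /(congr1 fine) := probability_setT P.
  apply: le_Rintegral => //; last 2 first.
  - exact: finite_measure_integrable_cst.
  - by move=> w _; exact: fC.
  - by apply: (@integrable_bounded _ _ _ _ _ C) => // [|w];
      [exact: measurableT_comp|rewrite normr_id fC].
rewrite -(ler_pM2l t0) -[X in X * `|I|]gtr0_norm// -normrM.
have -> : t * I = (expR (t ^+ 2 * curv) - 1) * \int[P]_w f (A w) - \int[P]_w r w.
  by rewrite rI; ring.
apply: (le_trans (ler_normB _ _)).
have h : `|(expR (t ^+ 2 * curv) - 1) * \int[P]_w f (A w)| <= t ^+ 2 * curv * expR curv * C.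
  rewrite normrM ler_pM//; apply: (le_trans (normr_expRB1_le _)).
  have q0 : 0 <= t ^+ 2 * curv by apply: mulr_ge0 => //; exact: sqr_ge0.
  rewrite (ger0_norm q0); apply: ler_wpM2l => //.
  by rewrite ler_expR ler_piMl// expr_le1// ltW.
apply: (le_trans (lerD h rle)); rewrite /K le_eqVlt; apply/orP; left; apply/eqP; ring.
Qed.

End GOEStein.

(** * First-order expansions along a symmetric direction *)
Section Slope.
Context {R : realType} (N : nat).
Variable D : 'M[R]_N.
Hypothesis symD : D^T = D.
Implicit Types f g : 'M[R]_N -> R[i].

(** A quantitative form of: [g] is the derivative of [f] in direction [D].  The
    uniform bounds are the hypotheses of [GOE_stein], and in this form they pass
    to sums, products and conjugates with explicit constants. *)
Definition has_slope f g :=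
  [/\ cmeasurable (fun x => f (sym_mx x)), cmeasurable (fun x => g (sym_mx x)) &
   exists C : R, [/\ forall X, X^T = X -> normc (f X) <= C,
     forall X, X^T = X -> normc (g X) <= C &
     forall X t, X^T = X -> 0 < t <= 1 ->
       normc (f (X + t *: D) - f X - t%:C * g X) <= C * t ^+ 2]].

Let symXD X t : X^T = X -> (X + t *: D)^T = X + t *: D.
Proof. by move=> symX; rewrite linearD linearZ/= symX symD. Qed.

Lemma has_slope_cst c : has_slope (fun=> c) (fun=> 0).
Proof.
split; [exact: cmeasurable_cst..|exists (normc c); split => [//|X _|X t _ _]].
  by rewrite normc0 normc_ge0.
by rewrite subrr mulr0 subr0 normc0 mulr_ge0 ?normc_ge0 ?sqr_ge0.
Qed.

Lemma has_slopeD f1 g1 f2 g2 : has_slope f1 g1 -> has_slope f2 g2 ->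
  has_slope (fun X => f1 X + f2 X) (fun X => g1 X + g2 X).
Proof.
move=> [mf1 mg1 [C1 [f1C g1C r1C]]] [mf2 mg2 [C2 [f2C g2C r2C]]].
split; [exact: cmeasurableD..|exists (C1 + C2); split => [X sX|X sX|X t sX t01]].
- by apply: (le_trans (le_normcD _ _)); apply: lerD; auto.
- by apply: (le_trans (le_normcD _ _)); apply: lerD; auto.
rewrite (_ : _ - _ = (f1 (X + t *: D) - f1 X - t%:C * g1 X) +
  (f2 (X + t *: D) - f2 X - t%:C * g2 X)); last by ring.
by apply: (le_trans (le_normcD _ _)); rewrite mulrDl; apply: lerD; auto.
Qed.

Lemma has_slopeM f1 g1 f2 g2 : has_slope f1 g1 -> has_slope f2 g2 ->
  has_slope (fun X => f1 X * f2 X) (fun X => g1 X * f2 X + f1 X * g2 X).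
Proof.
move=> [mf1 mg1 [C1 [f1C g1C r1C]]] [mf2 mg2 [C2 [f2C g2C r2C]]].
split; [exact: cmeasurableM|by apply: cmeasurableD; exact: cmeasurableM|].
have C10 : 0 <= C1 by apply: le_trans (f1C 0 _); rewrite ?trmx0 ?normc_ge0.
have C20 : 0 <= C2 by apply: le_trans (f2C 0 _); rewrite ?trmx0 ?normc_ge0.
have C120 : 0 <= C1 * C2 by exact: mulr_ge0.
exists (4 * (C1 * C2)); split => [X sX|X sX|X t sX t01].
- rewrite normcM; apply: (@le_trans _ _ (C1 * C2)); last lra.
  by apply: ler_pM; rewrite ?normc_ge0//; auto.
- apply: (le_trans (le_normcD _ _)); rewrite !normcM.
  apply: (@le_trans _ _ (C1 * C2 + C1 * C2)); last lra.
  by apply: lerD; apply: ler_pM; rewrite ?normc_ge0//; auto.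
set u1 := f1 (X + t *: D); set u2 := f2 (X + t *: D).
have u1C : normc u1 <= C1 by apply/f1C/symXD.
(* Leibniz rule with remainder, from [f_i (X + tD) = f_i X + t g_i X + r_i]. *)
rewrite (_ : _ - _ = u1 * (u2 - f2 X - t%:C * g2 X) +
   (u1 - f1 X - t%:C * g1 X) * (f2 X + t%:C * g2 X) +
   t%:C * t%:C * (g1 X * g2 X)); last by ring.
have /andP[t0 t1] := t01.
have nt : normc (t%:C : R[i]) = t by rewrite normc_real gtr0_norm.
have t20 : 0 <= C1 * C2 * t ^+ 2 by rewrite mulr_ge0 ?sqr_ge0.
have h1 : normc (u1 * (u2 - f2 X - t%:C * g2 X)) <= C1 * (C2 * t ^+ 2).
  by rewrite normcM; apply: ler_pM; rewrite ?normc_ge0//; exact: r2C.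
have h2 : normc ((u1 - f1 X - t%:C * g1 X) * (f2 X + t%:C * g2 X)) <=
    (C1 * t ^+ 2) * (C2 + C2).
  rewrite normcM; apply: ler_pM; rewrite ?normc_ge0//; first exact: r1C.
  apply: (le_trans (le_normcD _ _)); apply: lerD; first by auto.
  by rewrite normcM nt; apply: le_trans (g2C X sX); rewrite ler_piMl ?normc_ge0.
have h3 : normc (t%:C * t%:C * (g1 X * g2 X)) <= t * t * (C1 * C2).
  rewrite !normcM nt; apply: ler_wpM2l; first by rewrite mulr_ge0 ?ltW.
  by apply: ler_pM; rewrite ?normc_ge0//; auto.
apply: (le_trans (le_normcD _ _)); apply: (le_trans (lerD (le_normcD _ _) (lexx _))).
apply: (le_trans (lerD (lerD h1 h2) h3)).
rewrite le_eqVlt; apply/orP; left; apply/eqP; ring.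
Qed.

Lemma has_slopeZ c f g : has_slope f g ->
  has_slope (fun X => c * f X) (fun X => c * g X).
Proof.
move=> /(has_slopeM (has_slope_cst c)).
by under [X in has_slope _ X -> _]eq_fun do rewrite mul0r add0r.
Qed.

Lemma has_slope_conj f g : has_slope f g ->
  has_slope (fun X => (f X)^*) (fun X => (g X)^*).
Proof.
move=> [mf mg [C [fC gC rC]]].
split; [exact: cmeasurable_conj..|exists C; split => [X sX|X sX|X t sX t01]].
- by rewrite normc_conj; auto.
- by rewrite normc_conj; auto.
by rewrite -[t%:C]conjc_real -rmorphM -!rmorphB normc_conj; auto.
Qed.

Lemma has_slope_sum I (r : seq I) (f g : I -> 'M[R]_N -> R[i]) :
  (forall i, has_slope (f i) (g i)) ->
  has_slope (fun X => \sum_(i <- r) f i X) (fun X => \sum_(i <- r) g i X).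
Proof.
move=> fg; elim: r => [|i r ih].
  under eq_fun do rewrite big_nil; under [X in has_slope _ X]eq_fun do rewrite big_nil.
  exact: has_slope_cst.
under eq_fun do rewrite big_cons; under [X in has_slope _ X]eq_fun do rewrite big_cons.
exact: has_slopeD.
Qed.

Lemma le_normc_mulmx m n p (a b : R) (B : 'M[R[i]]_(m, n)) (C : 'M[R[i]]_(n, p)) :
  (forall i j, normc (B i j) <= a) -> (forall i j, normc (C i j) <= b) ->
  forall i j, normc ((B *m C) i j) <= a * b *+ n.
Proof.
move=> Ba Cb i j; rewrite mxE; apply: (le_trans (le_normc_sum _ _ _)).
rewrite -[X in _ *+ X](card_ord n) -sumr_const; apply: ler_sum => k _.
by rewrite normcM; apply: ler_pM; rewrite ?normc_ge0.
Qed.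

(** With [Y = X + tD], two uses of the resolvent identity give
    [G(Y) - G(X) + t G(X) D G(X) = t^2 G(Y) D G(X) D G(X)]. *)
Lemma has_slope_resolvent z i j : 0 < complex.Im z ->
  has_slope (fun X => resolvent z X i j)
    (fun X => - (resolvent z X *m map_mx (real_complex R) D *m resolvent z X) i j).
Proof.
move=> z0; pose E := map_mx (real_complex R) D.
have mG k l : cmeasurable (fun x => resolvent z (@sym_mx R N x) k l).
  apply: cmeasurable_invmx => [x|k' l']; first exact/shift_unitmx/tr_sym_mx.
  under eq_fun do rewrite mxE [X in X + _]mxE.
  apply: cmeasurableD; last exact: cmeasurable_cst.
  by apply: cmeasurable_real; exact: measurable_sym_mx.
split => //.
  under eq_fun do rewrite -mulN1r; apply: cmeasurableM; first exact: cmeasurable_cst.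
  apply: cmeasurable_mulmx => [k l|]; last exact: mG.
  by apply: cmeasurable_mulmx => [|k' l']; [exact: mG|exact: cmeasurable_cst].
pose dd := \sum_k \sum_l normc (E k l).
have Edd k l : normc (E k l) <= dd.
  rewrite /dd (bigD1 k)//= (bigD1 l)//= -addrA lerDl addr_ge0//.
    by apply: sumr_ge0 => ? _; exact: normc_ge0.
  by apply: sumr_ge0 => ? _; apply: sumr_ge0 => ? _; exact: normc_ge0.
set y := complex.Im z in z0.
have Gy (X : 'M[R]_N) k l : X^T = X -> normc (resolvent z X k l) <= y^-1.
  exact: normc_resolvent.
pose c1 := (y^-1 * dd *+ N) * y^-1 *+ N; pose c2 := (c1 * dd *+ N) * y^-1 *+ N.
have dd0 : 0 <= dd by apply: sumr_ge0 => ? _; apply: sumr_ge0 => ? _; exact: normc_ge0.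
have y0 : 0 <= y^-1 by rewrite invr_ge0 ltW.
have c10 : 0 <= c1 by rewrite !(mulr_ge0, mulrn_wge0).
have c20 : 0 <= c2 by rewrite !(mulr_ge0, mulrn_wge0).
have h1 X Y k l : X^T = X -> Y^T = Y -> normc ((resolvent z X *m E *m resolvent z Y) k l) <= c1.
  move=> sX sY; apply: le_normc_mulmx => [k' l'|k' l']; last exact: Gy.
  by apply: le_normc_mulmx => // ? ?; exact: Gy.
exists (y^-1 + c1 + c2); split => [X sX|X sX|X t sX t01].
- by have := Gy X i j sX; lra.
- by rewrite normcN; have := h1 X X i j sX sX; lra.
have sXt := symXD t sX; set Y := X + t *: D.
have GE : resolvent z Y - resolvent z X = - (t%:C *: (resolvent z Y *m E *m resolvent z X)).
  have YX : Y - X = t *: D by rewrite /Y addrC addKr.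
  by rewrite (resolvent_identity z0 sX sXt) YX map_mxZ -scalemxAr -scalemxAl.
have -> : resolvent z Y i j - resolvent z X i j -
     t%:C * - (resolvent z X *m E *m resolvent z X) i j =
   t%:C * t%:C * (resolvent z Y *m E *m resolvent z X *m E *m resolvent z X) i j.
  have := congr1 (fun U : 'M[R[i]]_N => (U *m E *m resolvent z X) i j) GE.
  rewrite !mulmxBl !mulNmx -!scalemxAl.
  have := congr1 (fun U : 'M[R[i]]_N => U i j) GE.
  set P1 := _ *m _ *m resolvent z X; set P2 := resolvent z X *m _ *m _.
  set P3 := P1 *m _ *m _.
  have sub (U W : 'M[R[i]]_N) : (U - W) i j = U i j - W i j by rewrite !mxE.
  have opp (c : R[i]) (U : 'M[R[i]]_N) : (- (c *: U)) i j = - (c * U i j) by rewrite !mxE.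
  rewrite !sub !opp => e1 e2; rewrite e1.
  have -> : P1 i j = P2 i j - t%:C * P3 i j by rewrite -[LHS](subrK (P2 i j)) e2 addrC.
  by ring.
have /andP[t0 t1] := t01.
rewrite !normcM normc_real gtr0_norm// -expr2 mulrC; apply: ler_wpM2r; first exact: sqr_ge0.
apply: (@le_trans _ _ c2); last by lra.
apply: le_normc_mulmx => [k l|k l]; last exact: Gy.
by apply: le_normc_mulmx => // k' l'; exact: h1.
Qed.

End Slope.

(** * The coordinate directions *)
Section PairDirection.
Context {R : realType} (N : nat).

(** The diagonal directions are doubled on purpose: this absorbs the factor 2 in
    the variance of the diagonal entries, so that integration by parts reads
    [E[N x_ij f] = E[D_ij f]] for all [i] and [j]. *)
Definition pair_mx (i j : 'I_N) : 'M[R]_N := delta_mx i j + delta_mx j i.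

Lemma tr_pair_mx i j : (pair_mx i j)^T = pair_mx i j.
Proof. by rewrite /pair_mx linearD/= !trmx_delta addrC. Qed.

Lemma mulmx_delta_mulmx (K : comNzRingType) m n p q (B : 'M[K]_(m, n)) (C : 'M[K]_(p, q))
  i j k l : (B *m delta_mx i j *m C) k l = B k i * C j l.
Proof.
rewrite -(mul_delta_mx (0 : 'I_1)) mulmxA -colE -mulmxA -rowE mxE big_ord1.
by rewrite !mxE.
Qed.

Lemma mxtrace_mul_pair_mx (A : 'M[R]_N) i j : A^T = A ->
  \tr (A *m pair_mx i j) = 2 * A i j.
Proof.
move=> symA; have tr_delta k l : \tr (A *m delta_mx k l) = A l k.
  rewrite -[_ *m _]mulmx1 /mxtrace.
  under eq_bigr do rewrite mulmx_delta_mulmx mxE.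
  rewrite (bigD1 l)//= eqxx mulr1 big1 ?addr0// => r /negbTE rl.
  by rewrite eq_sym rl mulr0.
by rewrite /pair_mx mulmxDr mxtraceD !tr_delta -{1}symA mxE; ring.
Qed.

Lemma mulmx_pair_mx_mulmx (G : 'M[R[i]]_N) i j k l :
  (G *m map_mx (real_complex R) (pair_mx i j) *m G) k l =
  G k i * G j l + G k j * G i l.
Proof.
by rewrite map_mxD !map_delta_mx mulmxDr mulmxDl [LHS]mxE !mulmx_delta_mulmx.
Qed.

End PairDirection.

(** * The approximate quadratic equation *)
Section SelfConsistency.
Context {R : realType} (z : R[i]).
Let y := complex.Im z.
Hypothesis y0 : 0 < y.

Definition mean_resolvent N (A : 'M[R]_N) : R[i] :=
  (N%:R^-1)%:C * \tr (resolvent z A).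

Definition defect (g : R[i]) : R[i] := 1 + z * g + g * g.

Section FixedSize.
Variables (N : nat).
Hypothesis N0 : (0 < N)%N.
Implicit Types A X : 'M[R]_N.
Local Notation G X := (resolvent z X).
Local Notation g X := (mean_resolvent X).

(* [dG], [dg], [dF] and [df] are the derivatives of the resolvent, of its
   normalized trace, of the defect and of [f] in direction [pair_mx i j]. *)
Let dG i j X := - (G X *m map_mx (real_complex R) (pair_mx i j) *m G X).
Let dg i j X := (N%:R^-1)%:C * \sum_k dG i j X k k.
Let dF i j X := 0 + z * dg i j X + (dg i j X * g X + g X * dg i j X).

Let slope_g i j : has_slope (pair_mx i j) (fun X => g X) (dg i j).
Proof.
apply: has_slopeZ; first exact: tr_pair_mx.
apply: has_slope_sum => k.
under [X in has_slope _ _ X]eq_fun do rewrite mxE.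
by apply: has_slope_resolvent => //; exact: tr_pair_mx.
Qed.

Let slope_F i j : has_slope (pair_mx i j) (fun X => defect (g X)) (dF i j).
Proof.
have sym := tr_pair_mx (R:=R) i j.
apply: has_slopeD => //; last exact: has_slopeM.
apply: has_slopeD => //; first exact: has_slope_cst.
exact: has_slopeZ.
Qed.

Let f i j X := G X j i * (defect (g X))^*.
Let df i j X := dG i j X j i * (defect (g X))^* + G X j i * (dF i j X)^*.

Let slope_f i j : has_slope (pair_mx i j) (f i j) (df i j).
Proof.
have sym := tr_pair_mx (R:=R) i j.
apply: has_slopeM => //; last exact: has_slope_conj.
under [X in has_slope _ _ X]eq_fun do rewrite mxE.
exact: has_slope_resolvent.
Qed.

Let Nneq0 : (N%:R : R) != 0. Proof. by rewrite pnatr_eq0 -lt0n. Qed.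

(* By integration by parts [Q] has mean zero; [S] and [E] are the two error terms
   of the quadratic equation. *)
Let S X := \sum_i \sum_j G X j i * G X j i.
Let E X := \sum_i \sum_j G X j i * (dF i j X)^*.
Let Q X := \sum_i \sum_j ((N%:R * X i j)%:C * f i j X - df i j X).

(** Uses [sum_ij x_ij G_ji = N (1 + z g)] and
    [sum_ij (G (E_ij + E_ji) G)_ji = S + (N g)^2]; the term [(N g)^2] is the one that
    completes [1 + z g] into the defect. *)
Let defect_identity X : X^T = X ->
  (N%:R ^+ 2)%:C * (defect (g X) * (defect (g X))^*) =
  Q X - S X * (defect (g X))^* + E X.
Proof.
move=> symX.
pose c := (defect (g X))^*.
have trE : \tr (G X) = N%:R%:C * g X.
  by rewrite /mean_resolvent mulrA -rmorphM mulfV// rmorph1 mul1r.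
have trAG : \sum_i \sum_j (X i j)%:C * G X j i = N%:R%:C + z * (N%:R%:C * g X).
  transitivity (\tr (map_mx (real_complex R) X *m G X)).
    by apply: eq_bigr => i _; rewrite mxE; apply: eq_bigr => j _; rewrite mxE.
  rewrite mulmx_resolvent// mxtraceD mxtrace1 mxtraceZ trE.
  by rewrite (_ : N%:R%:C = N%:R :> R[i]) ?rmorph_nat.
have trGG : \sum_i \sum_j G X j j * G X i i = N%:R%:C * g X * (N%:R%:C * g X).
  rewrite -trE /mxtrace mulr_sumr; apply: eq_bigr => i _; by rewrite mulr_suml.
pose dsum (F : 'I_N -> 'I_N -> R[i]) := \sum_i \sum_j F i j.
have dsumD F1 F2 : dsum F1 + dsum F2 = dsum (fun i j => F1 i j + F2 i j).
  by rewrite /dsum -big_split; apply: eq_bigr => i _; rewrite -big_split.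
have dsumB F1 F2 : dsum F1 - dsum F2 = dsum (fun i j => F1 i j - F2 i j).
  by rewrite /dsum -sumrB; apply: eq_bigr => i _; rewrite -sumrB.
have dsumM F a : a * dsum F = dsum (fun i j => a * F i j).
  by rewrite /dsum mulr_sumr; apply: eq_bigr => i _; rewrite mulr_sumr.
have -> : Q X = N%:R%:C * c * (N%:R%:C + z * (N%:R%:C * g X))
   + c * S X + c * (N%:R%:C * g X * (N%:R%:C * g X)) - E X.
  rewrite -trAG -trGG /S /E -!/(dsum _) !dsumM !dsumD dsumB.
  apply: eq_bigr => i _; apply: eq_bigr => j _.
  rewrite /f /df [dG _ _ _ _ _]mxE mulmx_pair_mx_mulmx rmorphM/= -/c.
  by ring.
rewrite rmorphXn -/c [X in _ * (X * c) = _]/defect.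
by ring.
Qed.

Lemma normc_mean_resolvent X : X^T = X -> normc (g X) <= y^-1.
Proof.
move=> symX; rewrite normcM normc_real ger0_norm ?invr_ge0//.
rewrite mulrC ler_pdivrMr ?ltr0n//; apply: (le_trans (le_normc_sum _ _ _)).
rewrite -[X in _ * X%:R](card_ord N) mulr_natr -sumr_const.
by apply: ler_sum => k _; exact: normc_resolvent.
Qed.

(* [K1] bounds the modulus of the defect, and [K2 / N] that of [dF]. *)
Let K1 := 1 + normc z * y^-1 + y^-1 * y^-1.
Let K2 := normc z * (2 * y ^- 2) + (2 * y ^- 2 * y^-1 + y^-1 * (2 * y ^- 2)).
Definition defect_bound := y ^- 2 * K1 + y^-1 * K2.

Let yV0 : 0 <= y^-1. Proof. by rewrite invr_ge0 ltW. Qed.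
Let yV20 : 0 <= y ^- 2. Proof. by rewrite invr_ge0 sqr_ge0. Qed.

Let normc_defect X : X^T = X -> normc (defect (g X)) <= K1.
Proof.
move=> symX; have gy := normc_mean_resolvent symX.
apply: (le_trans (le_normcD _ _)); apply: lerD; last first.
  by rewrite normcM ler_pM ?normc_ge0.
apply: (le_trans (le_normcD _ _)); rewrite normc1 normcM lerD2l.
by rewrite ler_wpM2l ?normc_ge0.
Qed.

Let normc_S X : X^T = X -> normc (S X) <= N%:R * y ^- 2.
Proof.
move=> symX; rewrite /S exchange_big/= mulrC mulr_natr.
rewrite -[X in _ *+ X](card_ord N) -sumr_const.
apply: (le_trans (le_normc_sum _ _ _)); apply: ler_sum => j _.
apply: (le_trans (le_normc_sum _ _ _)).
by under eq_bigr do rewrite normcM -expr2; exact: sum_normc_sqr_resolvent.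
Qed.

Let normc_dg i j X : X^T = X -> normc (dg i j X) <= N%:R^-1 * (2 * y ^- 2).
Proof.
move=> symX; rewrite normcM normc_real ger0_norm ?invr_ge0// ler_wpM2l ?invr_ge0//.
rewrite (_ : \sum_k _ = - (\sum_k (G X j k * G X k i) + \sum_k (G X i k * G X k j))).
  rewrite normcN mulr_natl mulr2n.
  apply: (le_trans (le_normcD _ _)); apply: lerD.
    apply: (le_trans (le_normc_sum _ _ _)).
    by under eq_bigr do rewrite normcM; exact: sum_normc_mul_resolvent.
  apply: (le_trans (le_normc_sum _ _ _)).
  by under eq_bigr do rewrite normcM; exact: sum_normc_mul_resolvent.
rewrite -big_split/= -sumrN; apply: eq_bigr => k _.
by rewrite /dG mxE mulmx_pair_mx_mulmx; congr (- _); ring.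
Qed.

Let normc_dF i j X : X^T = X -> normc (dF i j X) <= N%:R^-1 * K2.
Proof.
move=> symX; have gy := normc_mean_resolvent symX; have dgy := normc_dg i j symX.
rewrite /dF add0r /K2 !mulrDr.
apply: (le_trans (le_normcD _ _)); apply: lerD.
  by rewrite normcM mulrCA ler_wpM2l ?normc_ge0.
apply: (le_trans (le_normcD _ _)); apply: lerD.
  by rewrite normcM mulrA ler_pM ?normc_ge0.
by rewrite normcM mulrCA ler_pM ?normc_ge0.
Qed.

Let normc_E X : X^T = X -> normc (E X) <= N%:R * (y^-1 * K2).
Proof.
move=> symX; apply: (@le_trans _ _ (\sum_(i < N) \sum_(j < N) y^-1 * (N%:R^-1 * K2))).
  apply: (le_trans (le_normc_sum _ _ _)); apply: ler_sum => i _.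
  apply: (le_trans (le_normc_sum _ _ _)); apply: ler_sum => j _.
  rewrite normcM normc_conj; apply: ler_pM; rewrite ?normc_ge0//.
    exact: normc_resolvent.
  exact: normc_dF.
rewrite !sumr_const card_ord -[X in X *+ _]mulr_natr -[X in X <= _]mulr_natr.
rewrite le_eqVlt; apply/orP; left; apply/eqP.
by move: K2 (y^-1) => a b; field.
Qed.

Let defect_sqr_le X : X^T = X ->
  normc (defect (g X)) ^+ 2 <= N%:R ^- 2 * complex.Re (Q X) + N%:R^-1 * defect_bound.
Proof.
move=> symX; have /(congr1 (fun c : R[i] => complex.Re c)) := defect_identity symX.
rewrite mulc_conj -rmorphM/= cReD cReD cReN => e.
have N1 : 0 < N%:R :> R by rewrite ltr0n.
have h1 : - complex.Re (S X * (defect (g X))^*) <= N%:R * y ^- 2 * K1.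
  rewrite (le_trans (ler_norm _))// normrN (le_trans (normc_ge_normRe _))//.
  by rewrite normcM normc_conj ler_pM ?normc_ge0// ?normc_S ?normc_defect.
have h2 : complex.Re (E X) <= N%:R * (y^-1 * K2).
  by rewrite (le_trans (ler_norm _))// (le_trans (normc_ge_normRe _))// normc_E.
have N2 : 0 < N%:R ^+ 2 :> R by rewrite exprn_gt0.
rewrite -(ler_pM2l N2) e mulrDr mulrA mulfV ?gt_eqF// mul1r.
have -> : N%:R ^+ 2 * (N%:R^-1 * defect_bound) = N%:R * y ^- 2 * K1 + N%:R * (y^-1 * K2).
  by rewrite /defect_bound; move: K1 K2 (y^-1) (y ^- 2) => a b r s; field.
lra.
Qed.

Context d (T : measurableType d) (P : probability T R) (A : T -> 'M[R]_N).
Hypothesis hA : GOE P A.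

Let symA w : (A w)^T = A w. Proof. by case: hA. Qed.

Let stein_pair i j :
  P.-integrable setT (EFin \o (fun w => N%:R * A w i j * complex.Re (f i j (A w))
    - complex.Re (df i j (A w)))) /\
  \int[P]_w (N%:R * A w i j * complex.Re (f i j (A w))
    - complex.Re (df i j (A w))) = 0.
Proof.
have [[mf _] [mdf _] [C [fC dfC rC]]] := slope_f i j.
have ReC (c : R[i]) a : normc c <= a -> `|complex.Re c| <= a.
  exact/le_trans/normc_ge_normRe.
have [|||intf fE] := GOE_stein hA (tr_pair_mx i j) (C := C)
    (f := fun X => complex.Re (f i j X)) (g := fun X => complex.Re (df i j X)) mf mdf.
- by move=> X sX; apply/ReC/fC.
- by move=> X sX; apply/ReC/dfC.
- move=> X t sX t01.
  by rewrite -cRe_realM -!cReN -!cReD; exact/ReC/rC.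
have e w : N%:R / 2 * \tr (A w *m pair_mx i j) * complex.Re (f i j (A w)) =
    N%:R * A w i j * complex.Re (f i j (A w)).
  by rewrite mxtrace_mul_pair_mx//; field.
have intdf : P.-integrable setT (EFin \o (fun w => complex.Re (df i j (A w)))).
  apply: (@integrable_bounded _ _ _ _ _ C) => [|w].
    exact: (GOE_measurable_fun hA (f := fun X => complex.Re (df i j X))).
  by apply/ReC/dfC.
move: intf fE; rewrite (funext e).
move=> intf fE; split; first exact: integrable_realB.
by rewrite RintegralB// fE subrr.
Qed.

Lemma cmeasurable_mean_resolvent : cmeasurable (fun w => g (A w)).
Proof.
have [[m1 m2] _ _] := slope_g (Ordinal N0) (Ordinal N0).
split; first exact: (GOE_measurable_fun hA (f := fun X => complex.Re (g X))).
exact: (GOE_measurable_fun hA (f := fun X => complex.Im (g X))).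
Qed.

Lemma measurable_defect :
  measurable_fun setT (fun w => normc (defect (g (A w))) ^+ 2).
Proof.
have mg := cmeasurable_mean_resolvent.
apply: measurable_normc_sqr; apply: cmeasurableD; last exact: cmeasurableM.
apply: cmeasurableD; first exact: cmeasurable_cst.
by apply: cmeasurableM => //; exact: cmeasurable_cst.
Qed.

(* Unlike mere vanishing of the integral, this is stable under finite sums. *)
Let centered (u : T -> R) :=
  P.-integrable setT (EFin \o u) /\ \int[P]_w u w = 0.

Let centered_sum I (r : seq I) (u : I -> T -> R) :
  (forall i, centered (u i)) -> centered (fun w => \sum_(i <- r) u i w).
Proof.
move=> cu; elim: r => [|i r [ih1 ih2]].
  under eq_fun do rewrite big_nil; split; first exact: finite_measure_integrable_cst.
  by rewrite Rintegral_cst// mul0r.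
under eq_fun do rewrite big_cons; split.
  by apply: integrable_realD => //; case: (cu i).
by rewrite RintegralD//; [case: (cu i) => _ ->; rewrite ih2 addr0|case: (cu i)].
Qed.

Let centered_Q : centered (fun w => complex.Re (Q (A w))).
Proof.
under [X in centered X]eq_fun do rewrite cRe_sum.
apply: centered_sum => i; under [X in centered X]eq_fun do rewrite cRe_sum.
apply: centered_sum => j; under [X in centered X]eq_fun do rewrite cReD cReN cRe_realM.
exact: stein_pair.
Qed.

Lemma integrable_defect :
  P.-integrable setT (EFin \o (fun w => normc (defect (g (A w))) ^+ 2)).
Proof.
apply: (@integrable_bounded _ _ _ _ _ (K1 ^+ 2)); first exact: measurable_defect.
move=> w; rewrite ger0_norm ?sqr_ge0// ler_sqr ?nnegrE ?normc_ge0 ?normc_defect//.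
by rewrite (le_trans (normc_ge0 _) (normc_defect (symA w))).
Qed.

(** The mean-zero term disappears from the pointwise bound, and only the errors of
    order [1/N] remain. *)
Lemma GOE_defect_second_moment :
  \int[P]_w normc (defect (g (A w))) ^+ 2 <= N%:R^-1 * defect_bound.
Proof.
have [intQ Q0] := centered_Q.
have intc : P.-integrable setT (EFin \o (fun=> N%:R^-1 * defect_bound) : T -> \bar R).
  exact: finite_measure_integrable_cst.
have intZ := integrable_realZ (N%:R ^- 2) intQ.
apply: (le_trans (le_Rintegral measurableT integrable_defect (integrable_realD intZ intc)
  (fun w _ => defect_sqr_le (symA w)))).
rewrite RintegralD// RintegralZl// Q0 mulr0 add0r Rintegral_cst//.
rewrite (_ : fine _ = 1) ?mulr1//.
by have /(congr1 fine) := probability_setT P.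
Qed.

End FixedSize.
End SelfConsistency.

(** * The empirical measure and the resolvent *)

Lemma invmx_conj_diag_shift (F : fieldType) n (U : 'M[F]_n) (e : 'I_n -> F) (z : F) :
  U \in unitmx -> (forall k, e k - z != 0) ->
  invmx (invmx U *m diag_mx (\row_k e k) *m U - z%:M) =
  invmx U *m diag_mx (\row_k (1 / (e k - z))) *m U.
Proof.
move=> uU ez; pose L := diag_mx (\row_k (1 / (e k - z))).
have zE : z%:M = invmx U *m z%:M *m U.
  by rewrite mul_mx_scalar -scalemxAl mulVmx// scalemx1.
pose M := invmx U *m diag_mx (\row_k (e k - z)) *m U.
have -> : invmx U *m diag_mx (\row_k e k) *m U - z%:M = M.
  rewrite [X in _ - X]zE -mulmxBl -mulmxBr; congr (_ *m _ *m _).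
  by apply/matrixP => i j; rewrite !mxE -mulrnBl.
have ML : M *m (invmx U *m L *m U) = 1%:M.
  rewrite !mulmxA mulmxK// -[invmx U *m _ *m L]mulmxA mulmx_diag.
  rewrite (_ : diag_mx _ = 1%:M) ?mulmx1 ?mulVmx//.
  apply/matrixP => i j; rewrite !mxE.
  by case: eqP => // ->; rewrite mulrA mulr1 mulfV.
have [uM _] := mulmx1_unit ML.
by rewrite -[RHS](mulKmx uM) ML mulmx1.
Qed.

Section Spectral.
Context {R : realType} (N : nat).
Variable A : 'M[R]_N.
Hypothesis symA : A^T = A.
Local Notation AC := (map_mx (real_complex R) A).

(** The spectral theorem for Hermitian matrices; the eigenvalues [e] are real. *)
Let spectral_decomposition : exists (U : 'M[R[i]]_N) (e : 'I_N -> R),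
  U \in unitmx /\ AC = invmx U *m diag_mx (\row_k (e k)%:C) *m U.
Proof.
have hermAC : AC \is hermsymmx.
  apply: realsym_hermsym.
    by apply/is_hermitianmxP; rewrite expr0 scale1r map_mx_id// map_trmx symA.
  by apply/mxOverP => i j; rewrite mxE complex_real.
exists (spectralmx AC), (fun k => complex.Re (spectral_diag AC 0 k)).
split; first exact: spectral_unit.
have -> : \row_k (complex.Re (spectral_diag AC 0 k))%:C = spectral_diag AC.
  apply/matrixP => i j; rewrite ord1 mxE RRe_real//.
  by move/mxOverP : (hermitian_spectral_diag_real hermAC); apply.
exact/orthomx_spectralP/hermitian_normalmx.
Qed.

Let char_poly_eigen U (e : 'I_N -> R) : U \in unitmx ->
  AC = invmx U *m diag_mx (\row_k (e k)%:C) *m U ->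
  char_poly A = \prod_(x <- [seq e k | k <- enum 'I_N]) ('X - x%:P).
Proof.
move=> uU AE; apply: (map_poly_inj (real_complex R)).
rewrite map_char_poly AE /char_poly /char_poly_mx.
pose D := diag_mx (\row_k (e k)%:C).
have -> : 'X%:M - map_mx polyC (invmx U *m D *m U) =
    map_mx polyC (invmx U) *m char_poly_mx D *m map_mx polyC U.
  rewrite mulmxBr mulmxBl -!map_mxM -scalemx1 -scalemxAr mulmx1 -scalemxAl.
  by rewrite -map_mxM mulVmx// map_mx1.
rewrite !det_mulmx mulrAC -det_mulmx -map_mxM mulVmx// map_mx1 det1 mul1r.
rewrite -/(char_poly D) char_poly_trig ?diag_mx_is_trig//.
rewrite rmorph_prod big_map big_enum/=; apply: eq_bigr => k _.
by rewrite !mxE eqxx mulr1n rmorphB/= map_polyX map_polyC.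
Qed.

Let perm_eigenvalues (e : 'I_N -> R) :
  char_poly A = \prod_(x <- [seq e k | k <- enum 'I_N]) ('X - x%:P) ->
  perm_eq (eigenvalues A) [seq e k | k <- enum 'I_N].
Proof.
move=> pE; set s := map _ _ in pE *.
have p0 : char_poly A != 0 by rewrite monic_neq0// char_poly_monic.
apply/allP => x _; apply/eqP; rewrite -[RHS]mu_prod_XsubC -pE.
rewrite /eigenvalues count_flatten sumnE big_map big_map.
have rp := roots_on_rootsR p0.
under eq_bigr do rewrite count_nseq/=.
have [xr|xr] := boolP (x \in rootsR (char_poly A)).
  rewrite (bigD1_seq x)//= ?uniq_roots// eqxx mul1n big1 ?addn0// => r /negbTE rx.
  by rewrite rx mul0n.
rewrite big_seq big1 => [|r rr].
  by rewrite mupNroot//; move: xr; rewrite -rp.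
by case: eqP => [rx|]; rewrite ?mul0n//; rewrite rx (negbTE xr) in rr.
Qed.

(** In a diagonalizing basis the resolvent is diagonal with entries
    [1 / (e k - z)], and the real [e k] are the roots of the characteristic
    polynomial with multiplicity: the listed eigenvalues exhaust the spectrum. *)
Lemma trace_resolvent z : 0 < complex.Im z ->
  \tr (resolvent z A) = \sum_(x <- eigenvalues A) (1 / (x%:C - z)).
Proof.
move=> z0; have [U [e [uU AE]]] := spectral_decomposition.
have ez0 k : (e k)%:C - z != 0.
  apply/eqP => /(congr1 (fun c : R[i] => complex.Im c)); rewrite cImD cImN/= add0r.
  by move=> /eqP; rewrite oppr_eq0 gt_eqF.
rewrite (perm_big _ (perm_eigenvalues (char_poly_eigen uU AE))) big_map big_enum/=.
rewrite /resolvent AE invmx_conj_diag_shift//.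
rewrite mxtrace_mulC mulmxA mulmxV// mul1mx mxtrace_diag.
by apply: eq_bigr => k _; rewrite mxE.
Qed.

Lemma ge0_integral_empirical (f : R -> \bar R) :
  measurable_fun (setT : set (measurableTypeR R)) f -> (forall x, 0 <= f x)%E ->
  (\int[empirical_measure A]_x f x = (N%:R^-1)%:E * \sum_(x <- eigenvalues A) f x)%E.
Proof.
move=> mf f0; rewrite ge0_integral_mscale// ge0_integral_measure_sum//.
congr (_ * _)%E; rewrite (big_nth 0) big_mkord; apply: eq_bigr => k _.
by rewrite integral_dirac// diracT mul1e.
Qed.

Lemma Rintegral_empirical (f : R -> R) :
  measurable_fun (setT : set (measurableTypeR R)) f ->
  Rintegral (empirical_measure A) setT f = N%:R^-1 * \sum_(x <- eigenvalues A) f x.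
Proof.
move=> mf; have mEf : measurable_fun setT (EFin \o f) by exact/measurable_EFinP.
rewrite /Rintegral integralE !ge0_integral_empirical//; last 2 first.
- exact: measurable_funeneg.
- exact: measurable_funepos.
rewrite (eq_bigr (fun x => (Num.max (f x) 0)%:E)) => [|x _]; last first.
  by rewrite funeposE/= EFin_max.
rewrite [in X in (_ - X)%E](eq_bigr (fun x => (Num.max (- f x) 0)%:E)) => [|x _]; last first.
  by rewrite funenegE/= EFin_max.
rewrite !sumEFin -!EFinM -EFinB/= -mulrBr -sumrB; congr (_ * _).
apply: eq_bigr => x _; rewrite /Num.max; case: ifP; case: ifP; lra.
Qed.

End Spectral.

(** * Stieltjes transforms *)
Section Stieltjes.
Context {R : realType}.
Variable z : R[i].
Hypothesis z0 : 0 < complex.Im z.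

Lemma cmeasurable_cauchy : cmeasurable (fun x : measurableTypeR R => 1 / ((x : R)%:C - z)).
Proof.
under eq_fun do rewrite div1r.
apply: cmeasurableV; apply: cmeasurableD; last exact: cmeasurable_cst.
by apply: cmeasurable_real; exact: measurable_id.
Qed.

Lemma Im_cauchy_ge0 (x : R) : 0 <= complex.Im (1 / (x%:C - z)).
Proof.
rewrite div1r invc_conjE cIm_realM cImJ cImD cImN/= add0r opprK.
by rewrite mulr_ge0 ?(ltW z0)// invr_ge0 addr_ge0 ?sqr_ge0.
Qed.

Lemma Im_stieltjes_ge0 (mu : {finite_measure set (measurableTypeR R) -> \bar R}) :
  0 <= complex.Im (stieltjes mu z).
Proof. by apply: Rintegral_ge0 => x _; exact: Im_cauchy_ge0. Qed.

Lemma stieltjes_empirical N (A : 'M[R]_N) : A^T = A ->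
  stieltjes (empirical_measure A) z = mean_resolvent z A.
Proof.
move=> symA; have [m1 m2] := cmeasurable_cauchy.
rewrite /stieltjes /mean_resolvent trace_resolvent// !Rintegral_empirical//.
rewrite -cRe_sum -cIm_sum; set c := \sum_(_ <- _) _.
by case: c => a b; apply/eqP; rewrite eq_complex/=; apply/andP; split; apply/eqP; ring.
Qed.

End Stieltjes.

(** * Weighted Chebyshev polynomials of the second kind *)
Section WeightedChebyshev.
Context {R : realType}.
Implicit Types (t x : R) (k : nat).
Local Notation mu := (@lebesgue_measure R).

(** [wcheb k t] is [sqrt (1 - (t/2)^2) U_(k-1)(t/2)], that is [sin (k x)] at
    [t = 2 cos x].  Defining it by recursion rather than through [acos] makes
    continuity at the end points of [[-2, 2]] immediate. *)
Fixpoint wcheb k t : R := match k with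
  | 0 => 0
  | 1 => Num.sqrt (4 - t ^+ 2) / 2
  | (k'.+1 as k1).+1 => t * wcheb k1 t - wcheb k' t
  end.

Arguments wcheb : simpl never.

Lemma wchebSS k t : wcheb k.+2 t = t * wcheb k.+1 t - wcheb k t.
Proof. by []. Qed.

Lemma continuous_wcheb k : continuous (wcheb k).
Proof.
suff: continuous (wcheb k) /\ continuous (wcheb k.+1) by case.
elim: k => [|k [ih0 ih1]]; split => //.
- by move=> x; exact: cvg_cst.
- move=> x; apply: cvgM; last exact: cvg_cst.
  apply: continuous_comp; last exact: sqrt_continuous.
  by apply: cvgB; [exact: cvg_cst|exact: exprn_continuous].
- move=> x; apply: cvgB; last exact: ih0.
  by apply: cvgM; [exact: cvg_id|exact: ih1].
Qed.

Lemma sin_natSS k x : sin (k.+2%:R * x) = 2 * cos x * sin (k.+1%:R * x) - sin (k%:R * x).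
Proof.
have -> : k.+2%:R * x = k.+1%:R * x + x by rewrite -[k.+2]addn1 natrD; ring.
have -> : k%:R * x = k.+1%:R * x - x by rewrite -[k.+1]addn1 natrD; ring.
by rewrite sinB sinD; ring.
Qed.

Lemma wcheb_cos k x : 0 <= x <= pi -> wcheb k (2 * cos x) = sin (k%:R * x).
Proof.
move=> x0pi.
suff: wcheb k (2 * cos x) = sin (k%:R * x) /\
  wcheb k.+1 (2 * cos x) = sin (k.+1%:R * x) by case.
elim: k => [|k [ih0 ih1]]; split => //.
- by rewrite mul0r sin0.
- rewrite mul1r /wcheb.
  have -> : 4 - (2 * cos x) ^+ 2 = (2 * sin x) ^+ 2.
    by have := cos2Dsin2 x => /(congr1 (fun s => 4 * s)); lra.
  rewrite sqrtr_sqr ger0_norm; first by field.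
  by rewrite mulr_ge0 ?sin_ge0_pi.
- by rewrite wchebSS ih0 ih1 sin_natSS.
Qed.

Lemma normr_wcheb_le1 k t : -2 <= t <= 2 -> `|wcheb k t| <= 1.
Proof.
move=> t2; have t21 : -1 <= t / 2 <= 1 by lra.
have -> : t = 2 * cos (acos (t / 2)) by rewrite acosK ?in_itv//; field.
by rewrite wcheb_cos ?acos_ge0 ?acos_lepi// ler_norml sin_geN1 sin_le1.
Qed.

Lemma sin_natpi k : sin (k%:R * pi) = 0 :> R.
Proof.
elim: k => [|k ih]; first by rewrite mul0r sin0.
by rewrite -natr1 mulrDl mul1r sinDpi ih oppr0.
Qed.

(* A primitive of [2 sin ((k+1) x) sin x = cos (k x) - cos ((k+2) x)]. *)
Let prim k x : R := (if k == 0%N then x else sin (k%:R * x) / k%:R) -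
  sin (k.+2%:R * x) / k.+2%:R.

Let is_derive_prim k x :
  is_derive x 1 (prim k) (2 * sin (k.+1%:R * x) * sin x).
Proof.
have dM (c : R) f (a : R) : is_derive x 1 f a -> is_derive x 1 (fun y => c * f y) (c * a).
  by move=> df; exact: is_deriveZ.
have dsin j : (j != 0)%N -> is_derive x 1 (fun y => sin (j%:R * y) / j%:R) (cos (j%:R * x)).
  move=> j0.
  have h : is_derive x 1 (fun y => sin (j%:R * y)) (cos (j%:R * x) * (j%:R * 1)).
    by apply: (@is_derive1_comp R sin (fun y => j%:R * y)); exact: dM.
  under eq_fun do rewrite mulrC.
  apply: (is_derive_eq (dM j%:R^-1 _ _ h)).
  by rewrite mulr1 mulrCA mulVf ?mulr1// pnatr_eq0.
have -> : 2 * sin (k.+1%:R * x) * sin x = cos (k%:R * x) - cos (k.+2%:R * x).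
  have -> : k.+2%:R * x = k.+1%:R * x + x by rewrite -[k.+2]addn1 natrD; ring.
  have -> : k%:R * x = k.+1%:R * x - x by rewrite -[k.+1]addn1 natrD; ring.
  by rewrite cosB cosD; ring.
apply: is_deriveB; last exact: dsin.
rewrite /prim; case: eqP => [->|/eqP]; last exact: dsin.
by rewrite mul0r cos0; exact: is_derive_id.
Qed.

(** Substituting [t = 2 cos x], the integral becomes that of
    [2 sin ((k+1) x) sin x] over [[0, pi]]: orthogonality of the sines. *)
Lemma integral_wcheb k :
  (\int[mu]_(t in `[(-2)%R, 2%R]) (wcheb k.+1 t)%:E =
   (if k == 0%N then pi else 0)%:E)%E.
Proof.
have [e1 e2] : 2 * cos (0 : R) = 2 /\ 2 * cos (pi : R) = -2.
  by rewrite cos0 cospi; split; lra.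
have d2cos x : is_derive x 1 (fun x => 2 * cos x : R) (- (2 * sin x)).
  have h : is_derive x 1 (fun y => 2 * cos y : R) (2 * - sin x) by exact: is_deriveZ.
  by rewrite mulrN in h.
have d2cosE : derive1 (fun x => 2 * cos x : R) = (fun x => - (2 * sin x)).
  by apply/funext => x; rewrite derive1E; exact: derive_val.
have csin : continuous (fun x : R => - (2 * sin x)).
  move=> x; apply: cvgN; apply: cvgM; [exact: cvg_cst|exact: continuous_sin].
have ccos : continuous (fun x : R => 2 * cos x).
  move=> x; apply: cvgM; [exact: cvg_cst|exact: continuous_cos].
rewrite -{1}e2 -{2}e1 (@integration_by_substitution_decreasing _ (fun x => 2 * cos x))//.
- transitivity (\int[mu]_(x in `[0%R, pi]) (2 * sin (k.+1%:R * x) * sin x)%:E)%E.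
    apply: eq_integral => x; rewrite inE/= in_itv/= => xpi.
    rewrite d2cosE !fctE /= wcheb_cos//; congr (_%:E); ring.
  rewrite (@continuous_FTC2 _ _ (prim k)) ?pi_gt0//.
  + rewrite /prim !mulr0 sin0 !sin_natpi !mul0r.
    by case: eqP => _; rewrite -EFinB !subr0.
  + apply: continuous_subspaceT => x.
    apply: cvgM; last exact: continuous_sin.
    apply: cvgM; first exact: cvg_cst.
    apply: (@continuous_comp _ _ _ (fun x => k.+1%:R * x) sin); last exact: continuous_sin.
    by apply: cvgM; [exact: cvg_cst|exact: cvg_id].
  + have cprim : continuous (prim k).
      by move=> x; apply/differentiable_continuous/derivable1_diffP/ex_derive.
    split => [x _||]; first exact: ex_derive.
    * by apply: cvg_at_right_filter; exact: cprim.
    * by apply: cvg_at_left_filter; exact: cprim.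
  + by move=> x _; rewrite derive1E; exact: derive_val.
- exact: pi_ge0.
- by move=> x y xpi ypi xy; rewrite ltr_pM2l// ltr_cos.
- by move=> x _; rewrite d2cosE; exact: csin.
- by rewrite d2cosE; apply/cvg_ex; eexists; apply: cvg_at_right_filter; exact: csin.
- by rewrite d2cosE; apply/cvg_ex; eexists; apply: cvg_at_left_filter; exact: csin.
- split => [x _||]; first by apply: ex_derive.
  + by apply: cvg_at_right_filter; exact: ccos.
  + by apply: cvg_at_left_filter; exact: ccos.
- by apply: continuous_subspaceT; exact: continuous_wcheb.
Qed.

End WeightedChebyshev.
Arguments wcheb : simpl never.

(** * The Stieltjes transform of the semicircle law *)
Section Semicircle.
Context {R : realType}.
Local Notation mu := (@lebesgue_measure R).
Local Notation I2 := (`[(-2)%R, 2%R]%classic : set R).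

Let pdfE (t : R) : semicircle_pdf t = wcheb 1 t / pi.
Proof.
have pi0 : (pi : R) != 0 by rewrite gt_eqF// pi_gt0.
by rewrite /semicircle_pdf /wcheb; move: (pi) pi0 => p p0; field.
Qed.

Let measurable_wcheb k (D : set (measurableTypeR R)) : measurable_fun D (wcheb k).
Proof.
apply: (@measurable_funS _ _ _ _ setT) => //.
by apply: continuous_measurable_fun; exact: continuous_wcheb.
Qed.

Let integrable_wcheb k : mu.-integrable I2 (EFin \o wcheb k).
Proof.
apply: continuous_compact_integrable; first exact: segment_compact.
by apply: continuous_subspaceT; exact: continuous_wcheb.
Qed.

Let pdf_ge0 (t : R) : 0 <= semicircle_pdf t.
Proof. by rewrite mulr_ge0// ?sqrtr_ge0// invr_ge0 mulr_ge0// pi_ge0. Qed.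

Let measurable_pdf (D : set (measurableTypeR R)) :
  measurable_fun D (@semicircle_pdf R).
Proof.
rewrite (_ : semicircle_pdf = (fun t => wcheb 1 t * pi^-1)); last exact/funext.
by apply: measurable_funM => //; exact: measurable_wcheb.
Qed.

Lemma Rintegral_semicircle (f : R -> R) :
  measurable_fun (setT : set (measurableTypeR R)) f ->
  Rintegral semicircle setT f = \int[mu]_(t in I2) (f t * semicircle_pdf t).
Proof.
move=> mf; have mEf : measurable_fun setT (EFin \o f) by exact/measurable_EFinP.
have dens (g : R -> \bar R) : measurable_fun (setT : set (measurableTypeR R)) g ->
    (forall t, 0 <= g t)%E ->
    (\int[semicircle]_t g t = \int[mu]_(t in I2) (g t * (semicircle_pdf t)%:E))%E.
  by move=> mg g0; apply: ge0_integral_density.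
rewrite /Rintegral integralE [in RHS]integralE !dens//; last 2 first.
- exact: measurable_funeneg.
- exact: measurable_funepos.
congr (fine (_ - _)%E); apply: eq_integral => t _.
  rewrite !funeposE/= -!EFin_max -EFinM; congr (_%:E).
  by rewrite maxr_pMl// mul0r.
rewrite !funenegE/= -!EFin_max -EFinM; congr (_%:E).
by rewrite maxr_pMl// mul0r mulNr.
Qed.

(** The two roots have product 1 and sum [- z].  If they had modulus 1 they would be
    conjugate, and [z] would be real; so one of them is in the open unit disk, and
    [m + 1/m = - z] then forces [Im m > 0]. *)
Lemma semicircle_root (z : R[i]) : 0 < complex.Im z ->
  exists m : R[i], [/\ 1 + z * m + m * m = 0, normc m < 1 & 0 < complex.Im m].
Proof.
move=> z0.
pose s := sqrtc (z * z - 4); have s2 : s * s = z * z - 4 by rewrite -expr2 sqr_sqrtc.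
pose r (e : R[i]) := (- z + e * s) / 2.
have rootr e : e * e = 1 -> 1 + z * r e + r e * r e = 0.
  move=> e1; rewrite /r.
  have -> : 1 + z * ((- z + e * s) / 2) + (- z + e * s) / 2 * ((- z + e * s) / 2) =
    1 - z * z / 4 + (e * e) * (s * s) / 4 by field.
  by rewrite e1 s2; field.
have rr : r 1 * r (-1) = 1.
  have -> : r 1 * r (-1) = (z * z - s * s) / 4 by rewrite /r; field.
  by rewrite s2; field.
have small m : 1 + z * m + m * m = 0 -> normc m < 1 ->
    exists m : R[i], [/\ 1 + z * m + m * m = 0, normc m < 1 & 0 < complex.Im m].
  move=> mz m1; exists m; split => //.
  have m0 : m != 0.
    by apply: contra_eq_neq mz => ->; rewrite !mulr0 !addr0 oner_neq0.
  have n0 : 0 < normc m ^+ 2.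
    rewrite exprn_gt0// lt_neqAle normc_ge0 andbT eq_sym.
    by apply: contra_neq m0; exact: eq0_normc.
  (* This says [(1 - |m|^2) Im m = |m|^2 Im z]. *)
  have : complex.Im (m^* * (1 + z * m + m * m)) = 0 by rewrite mz mulr0.
  have -> : m^* * (1 + z * m + m * m) = m^* + (m * m^*) * (z + m) by ring.
  rewrite mulc_conj cImD cIm_realM cImJ cImD => e.
  have n1 : 0 < 1 - normc m ^+ 2.
    by rewrite subr_gt0 expr_lt1// normc_ge0.
  rewrite -(pmulr_rgt0 _ n1).
  suff -> : (1 - normc m ^+ 2) * complex.Im m = normc m ^+ 2 * complex.Im z.
    exact: mulr_gt0.
  lra.
have [lt1|gt1|eq1] := ltgtP (normc (r 1)) 1.
- by apply: small lt1; apply: rootr; rewrite mulr1.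
- apply: (small (r (-1))); first by apply: rootr; rewrite mulrNN mulr1.
  have /(congr1 (@normc R)) := rr; rewrite normcM normc1 => e.
  rewrite -(ltr_pM2l (lt_trans ltr01 gt1)) e mulr1; exact: gt1.
exfalso.
have rc : r (-1) = (r 1)^*.
  have := mulc_conj (r 1); rewrite eq1 expr1n => e.
  have r0 : r 1 != 0 by apply: contra_eq_neq rr => ->; rewrite mul0r eq_sym oner_neq0.
  by apply: (mulfI r0); rewrite rr e.
have : complex.Im (r 1 + r (-1)) = - complex.Im z.
  by rewrite -cImN; congr complex.Im; rewrite /r; field.
by rewrite rc cImD cImJ subrr => /eqP; rewrite eq_sym oppr_eq0 gt_eqF.
Qed.

Section StieltjesSemicircle.
Variables (z m : R[i]).
Hypothesis z0 : 0 < complex.Im z.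
Hypothesis mz : 1 + z * m + m * m = 0.
Hypothesis m1 : normc m < 1.

Let a := - m.

(** The generating function of the [wcheb k t]:  since [z = - (m + 1/m)],
    [(t - z) m = 1 - t a + a^2], and the three-term recurrence makes the product
    with the partial sum telescope. *)
Let telescope (t : R) n : (t%:C - z) * (m * \sum_(k < n) a ^+ k * (wcheb k.+1 t)%:C) =
  (wcheb 1 t)%:C - (a ^+ n * (wcheb n.+1 t)%:C - a ^+ n.+1 * (wcheb n t)%:C).
Proof.
elim: n => [|n ih]; first by rewrite big_ord0 !mulr0 expr0 mul1r subr0 subrr.
have ww : (wcheb n.+2 t)%:C = t%:C * (wcheb n.+1 t)%:C - (wcheb n t)%:C.
  by rewrite wchebSS rmorphB rmorphM.
have zm : z * m = - 1 - m * m by apply/eqP; rewrite -subr_eq0 -mz; apply/eqP; ring.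
rewrite big_ord_recr/= 2!mulrDr ih ww.
rewrite (_ : (t%:C - z) * (m * (a ^+ n * (wcheb n.+1 t)%:C)) =
  (t%:C * m - z * m) * (a ^+ n * (wcheb n.+1 t)%:C)); last by ring.
have ma : m = - a by rewrite opprK.
rewrite zm {}ma !exprS; ring.
Qed.

Let cauchyV_neq0 (t : R) : t%:C - z != 0.
Proof.
apply/eqP => /(congr1 (fun c : R[i] => complex.Im c)); rewrite cImD cImN/= add0r.
by move=> /eqP; rewrite oppr_eq0 gt_eqF.
Qed.

Let normc_cauchy (t : R) : normc (1 / (t%:C - z)) <= (complex.Im z)^-1.
Proof.
rewrite div1r normcV lef_pV2 ?posrE//.
  have := normc_ge_normIm (t%:C - z); rewrite cImD cImN/= add0r normrN gtr0_norm//.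
by rewrite (lt_le_trans z0)//; have := normc_ge_normIm (t%:C - z);
  rewrite cImD cImN/= add0r normrN gtr0_norm.
Qed.

Let remainder (t : R) n : -2 <= t <= 2 ->
  normc ((wcheb 1 t)%:C * (1 / (t%:C - z)) - m * \sum_(k < n) a ^+ k * (wcheb k.+1 t)%:C)
  <= 2 * (complex.Im z)^-1 * normc m ^+ n.
Proof.
move=> t2.
have -> : (wcheb 1 t)%:C * (1 / (t%:C - z)) - m * \sum_(k < n) a ^+ k * (wcheb k.+1 t)%:C =
    (a ^+ n * (wcheb n.+1 t)%:C - a ^+ n.+1 * (wcheb n t)%:C) * (1 / (t%:C - z)).
  apply: (mulfI (cauchyV_neq0 t)); rewrite mulrBr telescope.
  by field; exact: cauchyV_neq0.
have na k : normc (a ^+ k) = normc m ^+ k.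
  by elim: k => [|k ih]; rewrite ?expr0 ?normc1// !exprS normcM ih normcN.
have y0 : 0 <= (complex.Im z)^-1 by rewrite invr_ge0 ltW.
rewrite normcM mulrAC; apply: ler_pM; rewrite ?normc_ge0//.
apply: (le_trans (le_normcD _ _)); rewrite normcN !normcM !normc_real !na mulr_natl mulr2n.
have mn0 : 0 <= normc m ^+ n by rewrite exprn_ge0 ?normc_ge0.
apply: lerD; first by rewrite ler_piMr ?normr_wcheb_le1.
rewrite exprS -mulrA [normc m ^+ n * _]mulrC mulrA ler_piMl//.
by rewrite mulr_ile1 ?normc_ge0 ?normr_wcheb_le1// ltW.
Qed.

(** Stated for an abstract real-linear [phi] so as to cover the real and imaginary
    parts at once.  The partial sums of the expansion all integrate to [phi m],
    because only the term of index 0 has a nonzero integral, and the remainder is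
    of order [|m|^n]. *)
Let Rintegral_cauchy_part (phi : R[i] -> R) :
  (forall x y, phi (x + y) = phi x + phi y) ->
  (forall x, phi (- x) = - phi x) ->
  (forall (s : R) x, phi (s%:C * x) = s * phi x) ->
  (forall x, `|phi x| <= normc x) ->
  measurable_fun (setT : set (measurableTypeR R)) (fun t : R => phi (1 / (t%:C - z))) ->
  Rintegral semicircle setT (fun t => phi (1 / (t%:C - z))) = phi m.
Proof.
move=> phiD phiN phiZ phi_norm mphi.
have phi0 : phi 0 = 0 by rewrite -[X in phi X](mul0r 0) -(rmorph0 (real_complex R)) phiZ mul0r.
rewrite Rintegral_semicircle//.
pose f (t : R) := phi (1 / (t%:C - z)) * semicircle_pdf t.
rewrite -[LHS]/(\int[mu]_(t in I2) f t).
pose q n t := pi^-1 * \sum_(k < n) phi (m * a ^+ k) * wcheb k.+1 t.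
have mE : measurable (I2 : set (measurableTypeR R)) by exact: measurable_itv.
have intZ k c : mu.-integrable I2 (EFin \o (fun t => c * wcheb k t)).
  by have := integrableZl mE c (integrable_wcheb k).
have intq n : mu.-integrable I2 (EFin \o q n) /\
    \int[mu]_(t in I2) q n t = if n == 0%N then 0 else phi m.
  elim: n => [|n [ih1 ih2]].
    have -> : q 0%N = cst 0 by apply/funext => t; rewrite /q big_ord0 mulr0.
    split; first exact: integrable0.
    by rewrite Rintegral_cst// mul0r.
  have -> : q n.+1 = (fun t => q n t + pi^-1 * phi (m * a ^+ n) * wcheb n.+1 t).
    by apply/funext => t; rewrite /q big_ord_recr/= mulrDr mulrA.
  split; first exact: (integrableD mE ih1 (intZ _ _)).
  rewrite (RintegralD mE ih1 (intZ _ _)) ih2 (RintegralZl _ mE (integrable_wcheb _)).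
  rewrite /Rintegral integral_wcheb.
  case: n {ih1 ih2} => [|n] /=; last by rewrite mulr0 addr0.
  by rewrite add0r expr0 mulr1 mulrAC mulVf ?mul1r// gt_eqF// pi_gt0.
have phi_cauchy t : f t = pi^-1 * phi ((wcheb 1 t)%:C * (1 / (t%:C - z))).
  by rewrite phiZ /f pdfE mulrC -mulrA mulrCA.
have intf : mu.-integrable I2 (EFin \o f).
  apply: (le_integrable mE _ _ (intZ 1%N (pi^-1 * (complex.Im z)^-1))).
    apply/measurable_EFinP; apply: measurable_funM; first exact: measurable_funTS.
    exact: measurable_pdf.
  move=> t _; rewrite /= lee_fin phi_cauchy phiZ.
  move: (wcheb 1 t) => s; rewrite !normrM -!mulrA ler_wpM2l// mulrC ler_wpM2r//.
  by rewrite (le_trans (phi_norm _))// (le_trans (normc_cauchy t))// ler_norm.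
have fq n t : I2 t -> `|f t - q n t| <= pi^-1 * (2 * (complex.Im z)^-1 * normc m ^+ n).
  move=> t2; rewrite phi_cauchy /q -mulrBr normrM ger0_norm ?invr_ge0 ?pi_ge0//.
  rewrite ler_wpM2l ?invr_ge0 ?pi_ge0//.
  have -> : \sum_(k < n) phi (m * a ^+ k) * wcheb k.+1 t =
      phi (m * \sum_(k < n) a ^+ k * (wcheb k.+1 t)%:C).
    rewrite mulr_sumr (big_morph _ phiD phi0); apply: eq_bigr => k _.
    have -> : m * (a ^+ k * (wcheb k.+1 t)%:C) = (wcheb k.+1 t)%:C * (m * a ^+ k).
      by move: (a ^+ k) (wcheb k.+1 t)%:C => p s; ring.
    by rewrite phiZ mulrC.
  rewrite -phiN -phiD; apply: (le_trans (phi_norm _)); apply: remainder.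
  by move: t2; rewrite /= in_itv.
pose c := 4 * (pi^-1 * (2 * (complex.Im z)^-1)).
have bound n : `|\int[mu]_(t in I2) f t - phi m| <= c * normc m ^+ n.+1.
  have [intqn qn] := intq n.+1; rewrite -[phi m]qn -RintegralB//.
  have intfq := integrableB mE intf intqn.
  apply: (le_trans (le_normr_Rintegral mE intfq)).
  have -> : c * normc m ^+ n.+1 =
      \int[mu]_(t in I2) (pi^-1 * (2 * (complex.Im z)^-1 * normc m ^+ n.+1)).
    have muI2 : mu I2 = 4%:E.
      by rewrite lebesgue_measure_itv/= lte_fin ifT -?EFinB; [congr (_%:E)|]; lra.
    transitivity (pi^-1 * (2 * (complex.Im z)^-1 * normc m ^+ n.+1) * 4).
      by rewrite /c; ring.
    by rewrite Rintegral_cst//; congr (_ * _); exact/esym/(congr1 fine muI2).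
  apply: le_Rintegral => //.
  - exact: (integrable_norm intfq).
  - apply: continuous_compact_integrable; first exact: segment_compact.
    by apply: continuous_subspaceT => t; exact: cvg_cst.
  - by move=> t t2; exact: fq.
apply/eqP; rewrite -subr_eq0 -normr_le0.
have cvg0 : c * normc m ^+ n.+1 @[n --> \oo] --> (0 : R).
  rewrite -[X in _ --> X](mulr0 c); apply: cvgM; first exact: cvg_cst.
  rewrite (cvg_shiftS (GRing.exp (normc m))); apply: cvg_expr.
  by rewrite ger0_norm ?normc_ge0.
rewrite -(cvg_lim _ cvg0)//; apply: limr_ge.
  by apply/cvg_ex; exists 0.
by apply: nearW => n; exact: bound.
Qed.

Lemma stieltjes_semicircle : stieltjes semicircle z = m.
Proof.
have [mRe mIm] := cmeasurable_cauchy z.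
rewrite /stieltjes (@Rintegral_cauchy_part (fun x => complex.Re x))//; last 4 first.
- exact: cReD.
- exact: cReN.
- exact: cRe_realM.
- exact: normc_ge_normRe.
rewrite (@Rintegral_cauchy_part (fun x => complex.Im x))//; last 4 first.
- exact: cImD.
- exact: cImN.
- exact: cIm_realM.
- exact: normc_ge_normIm.
by case: m.
Qed.

End StieltjesSemicircle.
End Semicircle.

(** * Stability and deviation *)
Section Deviation.
Context {R : realType}.
Variables (z m : R[i]).
Hypothesis z0 : 0 < complex.Im z.
Hypothesis mz : 1 + z * m + m * m = 0.
Hypothesis m0 : 0 < complex.Im m.

(** [m] and [- z - m] are the roots of the defect, and the second one is at distance
    at least [Im z] below the closed upper half plane. *)
Lemma defect_stable (g : R[i]) : 0 <= complex.Im g ->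
  complex.Im z * normc (g - m) <= normc (defect z g).
Proof.
move=> g0; have -> : defect z g = (g + z + m) * (g - m).
  by rewrite -[LHS]subr0 -mz /defect; ring.
rewrite normcM ler_wpM2r ?normc_ge0//.
have e : complex.Im (g + z + m) = complex.Im g + complex.Im z + complex.Im m.
  by rewrite !cImD.
have [z0' m0'] := (ltW z0, ltW m0).
apply: (le_trans _ (normc_ge_normIm _)).
by rewrite e ger0_norm ?addr_ge0// addrAC lerDr addr_ge0.
Qed.

(** Markov's inequality for the squared modulus of the defect. *)
Lemma GOE_deviation d (T : measurableType d) (P : probability T R) N
    (A : T -> 'M[R]_N) (eps : R) : (0 < N)%N -> GOE P A -> 0 < eps ->
  (P [set w | (eps <= normc (stieltjes (empirical_measure (A w)) z - m))%R] <=
   ((complex.Im z * eps) ^- 2 * (N%:R^-1 * defect_bound z))%:E)%E.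
Proof.
move=> N0 hA eps0; have symA w : (A w)^T = A w by case: hA.
have y2 : 0 < (complex.Im z * eps) ^+ 2 by rewrite exprn_gt0// mulr_gt0.
pose D w := normc (defect z (mean_resolvent z (A w))) ^+ 2.
pose F w := normc (mean_resolvent z (A w) - m) ^+ 2.
have mD : measurable_fun setT D := measurable_defect z0 N0 hA.
have intD := integrable_defect z0 N0 hA.
have mF : measurable_fun setT F.
  apply: measurable_normc_sqr; apply: cmeasurableD; last exact: cmeasurable_cst.
  exact: (cmeasurable_mean_resolvent z0 N0 hA).
have FD w : (complex.Im z) ^+ 2 * F w <= D w.
  have h : 0 <= complex.Im z * normc (mean_resolvent z (A w) - m).
    by rewrite mulr_ge0 ?normc_ge0// ltW.
  rewrite -exprMn ler_sqr ?nnegrE ?normc_ge0//.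
  by apply: defect_stable; rewrite -stieltjes_empirical ?Im_stieltjes_ge0.
have yF0 w : 0 <= complex.Im z ^+ 2 * F w by apply: mulr_ge0; exact: sqr_ge0.
(* A measure is constrained on measurable sets only: this exhibits the event as a
   superlevel set of a measurable function. *)
have setE : [set w | eps <= normc (stieltjes (empirical_measure (A w)) z - m)] =
    setT `&` [set w | (((complex.Im z * eps) ^+ 2)%:E <= `|(complex.Im z ^+ 2 * F w)%:E|)%E].
  rewrite setTI; apply/funext => w /=; rewrite stieltjes_empirical// lee_fin.
  rewrite ger0_norm ?yF0// exprMn ler_pM2l ?exprn_gt0//.
  by rewrite ler_sqr ?nnegrE ?normc_ge0 ?(ltW eps0).
rewrite setE -(@lee_pmul2l _ ((complex.Im z * eps) ^+ 2)%:E) ?lte_fin//.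
apply: (le_trans (le_integral_abse P measurableT _ _)) => //.
  by apply/measurable_EFinP/measurable_funM.
rewrite -EFinM mulVKf ?gt_eqF//.
apply: (@le_trans _ _ (\int[P]_w (D w)%:E)%E).
  apply: ge0_le_integral => //.
  - by do 2 apply: measurableT_comp => //; exact: measurable_funM.
  - exact/measurable_EFinP.
  - move=> w _ /=; rewrite lee_fin ger0_norm ?yF0//; exact: FD.
rewrite -[leLHS]fineK; last by have := integrable_fin_num measurableT intD.
by rewrite lee_fin; exact: GOE_defect_second_moment.
Qed.

End Deviation.

Theorem theorem6p12 (R : realType) (d : nat -> measure_display)
  (T : forall N : nat, measurableType (d N))
  (P : forall N : nat, probability (T N) R)
  (A : forall N : nat, T N -> 'M[R]_N)
  (hA : forall N : nat, (0 < N)%N -> GOE (P N) (A N))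
  (z : R[i]) (hz : 0 < complex.Im z) (eps : R) (heps : 0 < eps) :
  P N [set w | eps <= ComplexField.Normc.normc
                 (stieltjes (empirical_measure (A N w)) z
                  - stieltjes semicircle z)] @[N --> \oo] --> 0%E.
Proof.
have [m [mz m1 m0]] := semicircle_root hz.
rewrite (stieltjes_semicircle hz mz m1).
pose c := (complex.Im z * eps) ^- 2 * defect_bound z.
apply: (@squeeze_cvge _ _ _ _ (cst 0%E) _ (fun N => (c * N%:R^-1)%:E)).
- exists 1%N => // N /= N1; rewrite measure_ge0/=.
  have := GOE_deviation hz mz m0 N1 (hA N N1) heps.
  by rewrite mulrCA mulrC mulrAC.
- exact: cvg_cst.
- apply: cvg_EFin; first exact: nearW.
  rewrite -[X in _ --> X](mulr0 c); apply: cvgM; first exact: cvg_cst.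
  rewrite -(cvg_shiftS (fun n => n%:R^-1 : R)); exact: cvg_harmonic.
Qed.
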